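(* Let $\mathcal{E}\rightarrow W$ be a holomorphic vector bundle over a Calabi-Yau $3$-fold $W$. Then the canonical projection $p_1:M=W\times S^1\to W$ gives (by pull-back of connections) a one-to-one correspondence between Hermitian Yang-Mills connections on $\mathcal{E}$ and $S^1$-invariant $G_2$-instantons on the pull-back bundle $p_1^*\mathcal{E}\to M$.
   Context: Let $\omega$ be the Kähler form and $\Omega$ the holomorphic volume form of the Calabi-Yau 3-fold $W$. The Riemannian product $M=W\times S^1$ is a $G_2$-manifold with $G_2$-structure $$\varphi=\omega\wedge d\theta+\mathrm{Im}\,\Omega,\qquad *\varphi=\tfrac12\omega\wedge\omega-\mathrm{Re}\,\Omega\wedge d\theta,$$ where $d\theta$ is the coordinate $1$-form on $S^1$, forms on $W$ are identified with their pull-backs to $M$, and $*$ is the Hodge star of the product of the Kähler metric on $W$ with the standard flat metric on $S^1$. A Hermitian Yang-Mills (HYM) connection on $\mathcal{E}$ is the Chern connection $A$ of a Hermitian metric on $\mathcal{E}$ (so its curvature satisfies $F_A\in\Omega^{1,1}(\mathrm{End}\,\mathcal{E})$) with vanishing $\omega$-trace $\hat F_A:=F_A\cdot\omega=0$. On a $G_2$-manifold $(M,\varphi)$, the 2-forms split as $\Omega^2=\Omega^2_+\oplus\Omega^2_-$, where pointwise $\Lambda^2_-\simeq\mathfrak{g}_2\subset\mathfrak{so}(7)\simeq\Lambda^2$ and $\Lambda^2_+$ is its orthogonal complement; the map $L_{*\varphi}:\eta\mapsto\eta\wedge*\varphi$ restricts to an isomorphism $\Omega^2_+\to\Omega^6$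 and vanishes on $\Omega^2_-$. A $G_2$-instanton is a connection $A$ whose curvature satisfies $F_A^+:=(L_{*\varphi}|_{\Omega^2_+})^{-1}(F_A\wedge*\varphi)=0$, i.e. $F_A\wedge*\varphi=0$.
   Formalization: S^1-invariant here includes having no dθ-component; instantons are unitary for some metric; for fixed holomorphic E they must also induce its ∂̄-operator on slices (a second bijection fixes no holomorphic structure). Otherwise false: d+ic dθ, d+ic dx_1 on T^6. *)

(* Defs.v *)
From HB Require Import structures.
From mathcomp Require Import all_boot all_order all_algebra.
From mathcomp Require Import all_classical all_reals all_analysis.
From mathcomp Require Import complex.
Set Implicit Arguments.
Unset Strict Implicit.
Unset Printing Implicit Defensive.
Import Order.TTheory GRing.Theory Num.Theory.
Import numFieldNormedType.Exports.
Local Open Scope classical_set_scope.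
Local Open Scope ring_scope.
Local Open Scope complex_scope.

Section Calculus.
Context {R : realType}.

(* Only used for open D, where it is the usual notion of a C^k function. *)
Fixpoint Ck n (k : nat) (D : set 'rV[R]_n) (f : 'rV[R]_n -> R) : Prop :=
  (forall x, D x -> {for x, continuous f}) /\
  match k with
  | 0%N => True
  | k'.+1 => forall j, (forall x, D x -> derivable f x 'e_j) /\
                       Ck k' D (fun x => 'D_'e_j f x)
  end.

Definition smooth n (D : set 'rV[R]_n) (f : 'rV[R]_n -> R[i]) : Prop :=
  forall k, Ck k D (fun x => complex.Re (f x)) /\
            Ck k D (fun x => complex.Im (f x)).

Definition partial n (j : 'I_n) (f : 'rV[R]_n -> R[i]) (x : 'rV[R]_n) : R[i] :=
  ('D_'e_j (fun y => complex.Re (f y)) x) +i*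
  ('D_'e_j (fun y => complex.Im (f y)) x).

(* C^n is R^(n + n) with real coordinates (x_1, .., x_n, y_1, .., y_n). *)
Definition zcoord n (x : 'rV[R]_(n + n)) (k : 'I_n) : R[i] :=
  (x 0 (lshift n k)) +i* (x 0 (rshift n k)).

Definition holomorphic n (D : set 'rV[R]_(n + n)) (f : 'rV[R]_(n + n) -> R[i]) :=
  smooth D f /\
  forall x, D x -> forall k : 'I_n,
    partial (lshift n k) f x + 'i%C * partial (rshift n k) f x = 0.

End Calculus.

(* The complexified exterior algebra of (R^n)^*: the value at S is the
   coefficient of dx_(s_1) /\ .. /\ dx_(s_k), where S = {s_1 < .. < s_k}. *)
Definition form (R : realType) (n : nat) := {ffun {set 'I_n} -> R[i]}.

HB.instance Definition _ (R : realType) n := GRing.Lmodule.on (form R n).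

Section ExteriorAlgebra.
Context {R : realType}.

Definition inversions n (S T : {set 'I_n}) : nat :=
  #|[set p : 'I_n * 'I_n | [&& p.1 \in S, p.2 \in T & (p.2 < p.1)%N]]|.

Definition wedge n (a b : form R n) : form R n :=
  [ffun S => \sum_(T in powerset S)
     (-1) ^+ inversions T (S :\: T) * a T * b (S :\: T)].

Definition form1 n : form R n := [ffun S => (S == finset.set0)%:R].

Definition dx n (j : 'I_n) : form R n := [ffun S => (S == [set j]%SET)%:R].

Definition homogeneous n (k : nat) (a : form R n) :=
  forall S : {set 'I_n}, #|S| != k -> a S = 0.

Definition conj_form n (a : form R n) : form R n := [ffun S => conjc (a S)].

Definition Re_form n (a : form R n) : form R n :=
  [ffun S => (complex.Re (a S))%:C].

Definition real_form n (a : form R n) := forall S, complex.Im (a S) = 0.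

(* The pull-back L^* : dy_k |-> \sum_l L k l dx_l by the linear map
   R^n -> R^m whose matrix, acting on column vectors, is L. *)
Definition pull m n (L : 'M[R]_(m, n)) (a : form R m) : form R n :=
  \sum_(S : {set 'I_m})
    a S *: \big[@wedge n/form1 n]_(k <- enum S) \sum_l (L k l)%:C *: dx l.

Definition dz n (k : 'I_n) : form R (n + n) :=
  dx (lshift n k) + 'i%C *: dx (rshift n k).

Definition type10 n (a : form R (n + n)) :=
  exists c : 'I_n -> R[i], a = \sum_k c k *: dz k.

Definition type11 n (a : form R (n + n)) :=
  exists c : 'I_n -> 'I_n -> R[i],
    a = \sum_k \sum_l c k l *: wedge (dz k) (conj_form (dz l)).

(* The skew matrix of the values a(e_k, e_l) of a 2-form a. *)
Definition mx2 n (a : form R n) : 'M[R[i]]_n :=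
  \matrix_(k, l) if (k < l)%N then a [set k; l]%SET
                 else if (l < k)%N then - a [set k; l]%SET else 0.

(* The complex structure acting on row vectors, e_(x_k) |-> e_(y_k) and
   e_(y_k) |-> - e_(x_k). *)
Definition Jmx n : 'M[R[i]]_(n + n) := block_mx 0 1%:M (- 1%:M) 0.

(* The Gram matrix of g(v, w) = w(v, J w). *)
Definition kahler_metric n (w : form R (n + n)) : 'M[R[i]]_(n + n) :=
  mx2 w *m (Jmx n)^T.

(* The inner product of 2-forms induced by the metric g of the (1,1)-form w,
   1/2 \sum g^(ac) g^(bd) a_(ab) b_(cd). *)
Definition inner2 n (w a b : form R (n + n)) : R[i] :=
  let G := invmx (kahler_metric w) in
  2%:R^-1 * \tr (G *m mx2 a *m G *m (mx2 b)^T).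

End ExteriorAlgebra.

(* Charts are total functions, meaningful on dom i only; chart_inv i is
   meaningful on the image of dom i under chart i. *)
Record atlas (R : realType) (n : nat) := Atlas {
  pt : topologicalType;
  idx : Type;
  dom : idx -> set pt;
  chart : idx -> pt -> 'rV[R]_n;
  chart_inv : idx -> 'rV[R]_n -> pt }.

Section Manifolds.
Context {R : realType}.

Definition complex_manifold n (X : atlas R (n + n)) : Prop :=
  [/\ hausdorff_space (pt X), @second_countable (pt X),
      forall p : pt X, exists i, dom i p,
      forall i : idx X,
        [/\ open (dom i), open (chart i @` dom i),
            forall p, dom i p -> chart_inv i (chart i p) = p,
            forall p, dom i p -> {for p, continuous (chart i)} &
            forall x, (chart i @` dom i) x ->
              {for x, continuous (@chart_inv _ _ X i)}]
    & forall i j (k : 'I_n),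
        holomorphic (@chart _ _ X i @` (dom i `&` dom j))
          (fun x => zcoord (chart j (chart_inv i x)) k)].

Variables (n : nat) (X : atlas R n).

Definition smooth_on (O : set (pt X)) (f : pt X -> R[i]) :=
  forall i : idx X, smooth (chart i @` (dom i `&` O)) (f \o chart_inv i).

(* The matrix of partial derivatives of the coordinate change from i to j. *)
Definition jac (i j : idx X) (p : pt X) : 'M[R]_n :=
  \matrix_(k, l) 'D_'e_l (fun x : 'rV[R]_n => chart j (chart_inv i x) 0 k)
                   (chart i p).

(* A field of forms is given by its components in every chart. *)
Definition form_field := idx X -> pt X -> form R n.

(* Smooth k-forms on the open set O; components are set to 0 where they are
   meaningless, so that equality of fields is equality of forms on O. *)
Definition is_form (k : nat) (O : set (pt X)) (a : form_field) : Prop :=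
  [/\ forall i p, ~ (dom i `&` O) p -> a i p = 0,
      forall i p, homogeneous k (a i p),
      forall i S, smooth (chart i @` (dom i `&` O))
                    (fun x => a i (chart_inv i x) S)
    & forall i j p, (dom i `&` dom j `&` O) p ->
        a i p = pull (jac i j p) (a j p)].

Definition d_form (a : form_field) : form_field := fun i p =>
  \sum_j wedge (dx j)
    [ffun S => partial j (fun x => a i (chart_inv i x) S) (chart i p)].

Definition d_fun (f : pt X -> R[i]) : form_field := fun i p =>
  \sum_j partial j (f \o chart_inv i) (chart i p) *: dx j.

End Manifolds.

Definition prod_atlas (R : realType) m n (X : atlas R m) (Y : atlas R n) :
    atlas R (m + n) :=
  {| pt := (pt X * pt Y)%type : topologicalType;
     idx := (idx X * idx Y)%type;
     dom := fun ij => dom ij.1 `*` dom ij.2;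
     chart := fun ij p => row_mx (chart ij.1 p.1) (chart ij.2 p.2);
     chart_inv := fun ij x =>
       (chart_inv ij.1 (lsubmx x), chart_inv ij.2 (rsubmx x)) |}.

Section Circle.
Variable R : realType.

Definition circle_set : set (R * R) := [set u | u.1 ^+ 2 + u.2 ^+ 2 = 1].

Lemma circle_setP (t : R) : (cos t, sin t) \in circle_set.
Proof. by rewrite inE /circle_set /= cos2Dsin2. Qed.

Definition expit (t : R) : set_type circle_set :=
  exist _ (cos t, sin t) (circle_setP t).

(* For each a in R, the complement of expit a with the angle coordinate theta
   in ]a, a + 2 pi[. *)
Definition circle : atlas R 1 :=
  {| pt := set_type circle_set : topologicalType;
     idx := R;
     dom := fun a => [set u | u <> expit a];
     chart := fun a u =>
       const_mx (xget 0 [set t | a < t < a + 2 * pi /\ expit t = u]);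
     chart_inv := fun a x => expit (x 0 0) |}.

End Circle.

Section CalabiYau.
Context {R : realType}.
Variables (W : atlas R (3 + 3)).

Definition kahler_form (w : form_field W) : Prop :=
  [/\ is_form 2 [set: pt W] w,
      forall i p, real_form (w i p),
      forall i p, dom i p -> type11 (w i p),
      forall i p, dom i p -> d_form w i p = 0
    & forall i p, dom i p -> forall v : 'rV[R]_(3 + 3), v != 0 ->
        let v' := map_mx (real_complex R) v in
        0 < (v' *m mx2 (w i p) *m (v' *m Jmx 3)^T) 0 0].

Definition holomorphic_volume_form (Om : form_field W) : Prop :=
  is_form 3 [set: pt W] Om /\
  exists f : idx W -> pt W -> R[i],
    [/\ forall i p, dom i p -> f i p != 0,
        forall i, holomorphic (chart i @` dom i) (f i \o chart_inv i)
      & forall i p, dom i p ->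
          Om i p = f i p *:
            wedge (wedge (dz (0 : 'I_3)) (dz (1 : 'I_3))) (dz (2%:R : 'I_3))].

(* The last condition, w^3 / 3! = (i / 8) Om /\ conj Om, says that the metric
   is Ricci-flat and fixes |Om|; it is what makes w /\ dtheta + Im Om a
   G_2-structure inducing the product metric. *)
Definition calabi_yau (w Om : form_field W) : Prop :=
  [/\ complex_manifold W, kahler_form w, holomorphic_volume_form Om
    & forall i p, dom i p ->
        6%:R^-1 *: wedge (wedge (w i p) (w i p)) (w i p) =
        ('i%C / 8%:R) *: wedge (Om i p) (conj_form (Om i p))].

End CalabiYau.

(* A rank r complex vector bundle, presented by transition matrices: the frame
   over tdom b is the frame over tdom a times trans a b. *)
Record bundle (R : realType) n (X : atlas R n) (r : nat) := Bundle {
  tidx : Type;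
  tdom : tidx -> set (pt X);
  trans : tidx -> tidx -> pt X -> 'M[R[i]]_r }.

Section Bundles.
Context {R : realType}.

Definition holomorphic_bundle n (X : atlas R (n + n)) r (E : bundle X r) :=
  [/\ forall a : tidx E, open (tdom a),
      forall p, exists a : tidx E, tdom a p,
      forall (a : tidx E) p, tdom a p -> trans a a p = 1%:M,
      forall (a b c : tidx E) p, (tdom a `&` tdom b `&` tdom c) p ->
        trans a b p *m trans b c p = trans a c p
    & forall (a b : tidx E) (i : idx X) k l,
        holomorphic (chart i @` (dom i `&` (tdom a `&` tdom b)))
          (fun x => trans a b (chart_inv i x) k l)].

Variables (n : nat) (X : atlas R n) (r : nat) (E : bundle X r).

(* A matrix-valued form for each local frame and each chart. *)
Definition local_forms := tidx E -> idx X -> pt X -> 'M[form R n]_r.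

(* Connection matrices, with gauge law g_ab A_b = A_a g_ab + d g_ab. *)
Definition connection (A : local_forms) : Prop :=
  (forall (a : tidx E) k l, is_form 1 (tdom a) (fun i p => A a i p k l)) /\
  (forall (a b : tidx E) i p, (tdom a `&` tdom b `&` dom i) p -> forall k l,
     \sum_m trans a b p k m *: A b i p m l =
     \sum_m trans a b p m l *: A a i p k m
       + d_fun (fun q => trans a b q k l) i p).

(* F = dA + A /\ A *)
Definition curvature (A : local_forms) : local_forms := fun a i p =>
  \matrix_(k, l) (d_form (fun j q => A a j q k l) i p
                  + \sum_m wedge (A a i p k m) (A a i p m l)).

(* h(s, t) = (conj s)^T H_a t for the components s, t in the frame a. *)
Definition hermitian_metric (H : tidx E -> pt X -> 'M[R[i]]_r) : Prop :=
  [/\ forall a k l, smooth_on (tdom a) (fun p => H a p k l),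
      forall a b p, (tdom a `&` tdom b) p ->
        H b p = (map_mx conjc (trans a b p))^T *m H a p *m trans a b p
    & forall a p, tdom a p -> forall v : 'cV[R[i]]_r, v != 0 ->
        0 < ((map_mx conjc v)^T *m H a p *m v) 0 0].

(* dH = (conj A)^T H + H A *)
Definition unitary (H : tidx E -> pt X -> 'M[R[i]]_r) (A : local_forms) :=
  forall (a : tidx E) i p, (tdom a `&` dom i) p -> forall k l,
    d_fun (fun q => H a q k l) i p =
    \sum_m (H a p m l *: conj_form (A a i p m k) + H a p k m *: A a i p m l).

End Bundles.

Section HermitianYangMills.
Context {R : realType}.
Variables (W : atlas R (3 + 3)) (r : nat) (E : bundle W r).

(* The local frames of E are holomorphic, so A induces the dbar-operator of E
   iff its connection matrices are of type (1,0). *)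
Definition chern_connection (H : tidx E -> pt W -> 'M[R[i]]_r)
    (A : local_forms E) : Prop :=
  [/\ connection A, unitary H A
    & forall (a : tidx E) i p, (tdom a `&` dom i) p ->
        forall k l, type10 (A a i p k l)].

Definition omega_trace_free (w : form_field W) (A : local_forms E) : Prop :=
  forall (a : tidx E) i p, (tdom a `&` dom i) p -> forall k l,
    inner2 (w i p) (curvature A a i p k l) (w i p) = 0.

Definition curvature11 (A : local_forms E) : Prop :=
  forall (a : tidx E) i p, (tdom a `&` dom i) p -> forall k l,
    type11 (curvature A a i p k l).

(* HYM connections on the holomorphic bundle E. *)
Definition HYM (w : form_field W) (A : local_forms E) : Prop :=
  (exists2 H, hermitian_metric H & chern_connection H A) /\
  omega_trace_free w A.

(* HYM connections on the smooth bundle underlying E: no holomorphic structure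
   is prescribed.  The (1,1) condition makes the (0,1)-part of A a holomorphic
   structure, for which A is the Chern connection of H. *)
Definition HYM_smooth (w : form_field W) (A : local_forms E) : Prop :=
  [/\ connection A, exists2 H, hermitian_metric H & unitary H A,
      curvature11 A & omega_trace_free w A].

End HermitianYangMills.

Section G2.
Context {R : realType}.
Variable (W : atlas R (3 + 3)).

Definition WxS1 : atlas R (3 + 3 + 1) := prod_atlas W (circle R).

(* The pull-back of forms by the first projection. *)
Definition p1_form (a : form_field W) : form_field WxS1 := fun ia q =>
  if `[< @dom _ _ WxS1 ia q >] then pull (row_mx 1%:M 0) (a ia.1 q.1) else 0.

Definition theta_idx : 'I_(3 + 3 + 1) := rshift (3 + 3) (0 : 'I_1).

Definition dtheta : form R (3 + 3 + 1) := dx theta_idx.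

(* 1/2 w /\ w - Re Om /\ dtheta, which is the Hodge dual of the G_2-structure
   w /\ dtheta + Im Om for the product metric. *)
Definition star_phi (w Om : form_field W) : form_field WxS1 := fun ia q =>
  2%:R^-1 *: wedge (p1_form w ia q) (p1_form w ia q)
  - wedge (Re_form (p1_form Om ia q)) dtheta.

Variables (r : nat) (E : bundle W r).

Definition p1_bundle : bundle WxS1 r :=
  {| tidx := tidx E;
     tdom := fun a => [set q : pt WxS1 | tdom a q.1];
     trans := fun a b (q : pt WxS1) => trans a b q.1 |}.

Definition p1_connection (A : local_forms E) : local_forms p1_bundle :=
  fun a ia q => \matrix_(k, l) p1_form (fun i p => A a i p k l) ia q.

(* Invariance for the action of S^1 on p1^* E which fixes the fibres of E.
   Rotations are translations in the angle charts, so the first condition is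
   invariance under rotations; the second one says that parallel transport
   along the circles {p} x S^1 is the action itself.  It excludes, e.g., the
   flat connections d + i c dtheta on the trivial line bundle, which are
   invariant under rotations but not pulled back from W. *)
Definition S1_invariant (B : local_forms p1_bundle) : Prop :=
  (forall (a : tidx E) i s t p u v,
     @dom _ _ WxS1 (i, s) (p, u) -> @dom _ _ WxS1 (i, t) (p, v) ->
     B a (i, s) (p, u) = B a (i, t) (p, v)) /\
  (forall (a : tidx E) ia q k l, B a ia q k l [set theta_idx]%SET = 0).

(* F_B /\ *phi = 0 *)
Definition G2_instanton (w Om : form_field W) (B : local_forms p1_bundle) :=
  [/\ connection B, exists2 K, hermitian_metric K & unitary K B
    & forall (a : tidx E) ia q, (@dom _ _ WxS1 ia q /\ tdom a q.1) ->
        forall k l, wedge (curvature B a ia q k l) (star_phi w Om ia q) = 0].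

(* Along the slices W x {u}, B induces the dbar-operator of E. *)
Definition induces_dbar (B : local_forms p1_bundle) : Prop :=
  forall (a : tidx E) ia q, (@dom _ _ WxS1 ia q /\ tdom a q.1) ->
    forall k l, exists c : 'I_3 -> R[i],
      pull (col_mx 1%:M 0) (B a ia q k l) = \sum_m c m *: dz m.

End G2.

(* Main.v *)
From HB Require Import structures.
Require Import Defs.
From mathcomp Require Import all_boot all_order all_algebra.
From mathcomp Require Import all_classical all_reals all_analysis.
From mathcomp Require Import complex ring lra.
Set Implicit Arguments.
Unset Strict Implicit.
Unset Printing Implicit Defensive.
Import Order.TTheory GRing.Theory Num.Theory.
Import numFieldNormedType.Exports.

(** Over a chart, a form F pulled back from W satisfies
      F /\ *phi = 1/2 F /\ w /\ w - F /\ Re Om /\ dtheta,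
    and since only the second summand contains dtheta, the product vanishes iff
    both summands do [cyl_wedge_star].

    For a 2-form F on C^3 the two conditions are the two halves of the
    Hermitian Yang-Mills condition.  Om is a multiple of dz_1 /\ dz_2 /\ dz_3, so
    F /\ Om sees the (0,2)-component of F only and F /\ conj Om the
    (2,0)-component only, and these products have different types; hence
    F /\ Re Om = 0 iff F has type (1,1) [wedge_Re_vol].  And F /\ w /\ w is a
    nonzero multiple of the w-trace of F: the inverse of the skew matrix of w is
    made of the cofactors of its Pfaffian, which are the coefficients of w /\ w
    [inner2_wedge]; the Pfaffian is nonzero because w^3 is a nonzero multiple of
    Om /\ conj Om [kahler_cube].

    As the curvature of a pulled back connection is the pull-back of the
    curvature [curvature_p1], a connection on W with a compatible metric pulls
    back to a G_2-instanton iff its curvature has type (1,1) and vanishing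
    w-trace [instanton_p1].  For a Chern connection the type condition is
    automatic: the (0,2)-component vanishes because the connection matrices have
    type (1,0), and unitarity, differentiated once more with the help of the
    symmetry of second derivatives [schwarz], turns this into the vanishing of
    the (2,0)-component [chern_curv].

    Conversely an invariant connection has no dtheta component and does not
    depend on the angle, so it is the pull-back of its restriction to one slice
    W x {u0} [p1_slice_connection]; restriction to the slice also shows that
    pull-back is injective.

    The exterior algebra is handled by splitting index sets according to whether
    they contain the last index: a form on R^(n + 1) is a pair of forms on R^n
    [slice].  For the projection from R^7 to R^6 this separates the dtheta part;
    iterated, it turns coefficients into functions of bit sequences on which the
    wedge product computes [bits_wedge], so that the algebra in dimension six
    becomes polynomial identities. *)

(** * Forms on a product with a line, sliced along the last coordinate *)

Lemma sum_pick (K : pzRingType) (I : finType) (c : I -> K) k :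
  (\sum_j c j * (j == k)%:R = c k)%R.
Proof.
rewrite (bigD1 k) //= eqxx mulr1 big1 ?addr0 // => j /negPf ->.
by rewrite mulr0.
Qed.

Section Slices.
Local Open Scope ring_scope.
Local Open Scope complex_scope.
Context {R : realType}.
Local Notation form := Defs.form.

Lemma form_scaleE n (c : R[i]) (a : form R n) S : (c *: a) S = c * a S.
Proof. exact: ffunE. Qed.

Lemma form_addE n (a b : form R n) S : (a + b) S = a S + b S.
Proof. exact: ffunE. Qed.

Lemma form_sumE n I (s : seq I) (F : I -> form R n) S :
  (\sum_(i <- s) F i) S = \sum_(i <- s) F i S.
Proof.
elim: s => [|i s IH]; first by rewrite !big_nil ffunE.
by rewrite !big_cons form_addE IH.
Qed.

(** Every set of indices below n + 1 has this form; b tells whether it contains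
    the last index. *)
Definition ext n (b : bool) (S : {set 'I_n}) : {set 'I_(n + 1)} :=
  [set k | match fintype.split k with inl j => j \in S | inr _ => b end]%SET.

(** A form is [slice false a + slice true a /\ dx_n] with dx_n the last
    coordinate covector. *)
Definition slice n (b : bool) (a : form R (n + 1)) : form R n :=
  [ffun S => a (ext b S)].

Lemma in_ext_l n b (S : {set 'I_n}) j : (lshift 1 j \in ext b S) = (j \in S).
Proof. by rewrite inE (unsplitK (inl j)). Qed.

Lemma in_ext_r n b (S : {set 'I_n}) j : (rshift n j \in ext b S) = b.
Proof. by rewrite inE (unsplitK (inr j)). Qed.

Lemma ord_addP n (P : 'I_(n + 1) -> Prop) :
  (forall j, P (lshift 1 j)) -> P (rshift n 0) -> forall k, P k.
Proof.
move=> Pl Pr k; rewrite -(splitK k); case: (fintype.split k) => j //=.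
by rewrite ord1.
Qed.

Lemma ext_surj n (T : {set 'I_(n + 1)}) :
  T = ext (rshift n 0 \in T) [set j | lshift 1 j \in T]%SET.
Proof.
by apply/setP; elim/ord_addP => [j|]; rewrite ?in_ext_l ?in_ext_r ?inE.
Qed.

Lemma ext_inj n b c (S T : {set 'I_n}) :
  (ext b S == ext c T) = (b == c) && (S == T).
Proof.
apply/eqP/andP => [e|[/eqP -> /eqP ->]//]; split; apply/eqP.
  by rewrite -(in_ext_r b S 0) e in_ext_r.
by apply/setP => j; rewrite -(in_ext_l b S) e in_ext_l.
Qed.

Lemma sub_ext n b c (S T : {set 'I_n}) :
  (ext b S \subset ext c T) = (b ==> c) && (S \subset T).
Proof.
apply/fintype.subsetP/andP => [e|[bc /fintype.subsetP sST]].
  split; first by apply/implyP => b1; move: (e (rshift n 0)); rewrite !in_ext_r; apply.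
  by apply/fintype.subsetP => j jS; move: (e (lshift 1 j)); rewrite !in_ext_l; apply.
by elim/ord_addP => [j|]; rewrite ?in_ext_l ?in_ext_r; [apply: sST|apply/implyP].
Qed.

Lemma setD_ext n b c (S T : {set 'I_n}) :
  (ext b S :\: ext c T)%SET = ext (b && ~~ c) (S :\: T)%SET.
Proof.
apply/setP; elim/ord_addP => [j|].
  by rewrite inE !in_ext_l !inE.
by rewrite inE !in_ext_r andbC.
Qed.

Lemma ext_set1l n (j : 'I_n) : [set lshift 1 j]%SET = ext false [set j]%SET.
Proof.
apply/setP; elim/ord_addP => [i|]; rewrite ?in_ext_l ?in_ext_r ?inE.
  by rewrite (inj_eq (@lshift_inj _ _)).
by rewrite eq_rlshift.
Qed.

Lemma ext_set1r n : [set rshift n 0]%SET = ext true (finset.set0 : {set 'I_n}).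
Proof.
apply/setP; elim/ord_addP => [i|]; rewrite ?in_ext_l ?in_ext_r ?inE ?eqxx//.
by rewrite eq_lrshift.
Qed.

Lemma card_sum_mem (I : finType) (A : {set I}) : #|A| = (\sum_(i : I) (i \in A))%N.
Proof. by rewrite -sum1_card big_mkcond. Qed.

Lemma card_ext n b (S : {set 'I_n}) : #|ext b S| = (#|S| + b)%N.
Proof.
rewrite !card_sum_mem big_split_ord big_ord1 in_ext_r; congr (_ + _)%N.
by apply: eq_bigr => j _; rewrite in_ext_l.
Qed.

Lemma inversionsE n (S T : {set 'I_n}) :
  inversions S T = (\sum_i \sum_j [&& i \in S, j \in T & (j < i)%N])%N.
Proof.
rewrite /inversions pair_big -sum1_card big_mkcond; apply: eq_bigr => -[i j] _ /=.
rewrite (_ : (_ \in _) = [&& i \in S, j \in T & (j < i)%N]); first by case: ifP.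
by apply/idP/idP => [/set_mem|?] //; rewrite mem_set.
Qed.

Lemma inversions_ext n b c (S T : {set 'I_n}) :
  inversions (ext b S) (ext c T) = (inversions S T + b * #|T|)%N.
Proof.
rewrite !inversionsE big_split_ord /= big_ord1; congr (_ + _)%N.
  apply: eq_bigr => i _; rewrite big_split_ord /= big_ord1 in_ext_r.
  rewrite [X in (_ + X)%N](_ : _ = 0%N) ?addn0; last first.
    by rewrite in_ext_l /= ltnNge ltnW ?andbF//= addn0; exact: ltn_ord.
  by apply: eq_big => // j _; rewrite !in_ext_l.
rewrite big_split_ord /= big_ord1 !in_ext_r /= ltnn !andbF.
rewrite card_sum_mem big_distrr /=.
by rewrite addn0; apply: eq_bigr => j _; rewrite in_ext_l ?addn0 (ltn_ord j) andbT mulnb.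
Qed.

Lemma big_ext n (F : {set 'I_(n + 1)} -> R[i]) (b : bool) (S : {set 'I_n}) :
  \sum_(T in powerset (ext b S)) F T =
  \sum_(T in powerset S) F (ext false T) +
  (if b then \sum_(T in powerset S) F (ext true T) else 0).
Proof.
have H c : \sum_(T in powerset (ext b S) | (rshift n 0 \in T) == c) F T =
   if c ==> b then \sum_(T in powerset S) F (ext c T) else 0.
  rewrite (reindex_onto (ext c) (fun T : {set 'I_(n + 1)} => [set j | lshift 1 j \in T]%SET)) /=.
    case: ifP => cb.
      apply: eq_bigl => T; rewrite !powersetE sub_ext cb /= in_ext_r eqxx andbT.
      rewrite (_ : [set j | _]%SET = T) ?eqxx ?andbT//.
      by apply/setP => j; rewrite inE in_ext_l.
    by rewrite big_pred0 // => T; rewrite !powersetE sub_ext cb.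
  by move=> T /andP[_ /eqP <-]; rewrite -ext_surj.
rewrite (bigID (fun T : {set 'I_(n + 1)} => (rshift n 0 \in T) == false)) /= H; congr (_ + _).
under eq_bigl => T do rewrite eqbF_neg negbK -[rshift n 0 \in T]eqb_id.
by rewrite H /=.
Qed.

(** The sign for moving a covector past a form. *)
Definition grade_sign n (a : form R n) : form R n :=
  [ffun S : {set 'I_n} => (-1) ^+ #|S| * a S].

Lemma slice0_wedge n (a b : form R (n + 1)) :
  slice false (wedge a b) = wedge (slice false a) (slice false b).
Proof.
apply/ffunP => S; rewrite !ffunE big_ext addr0; apply: eq_bigr => T _.
by rewrite !ffunE setD_ext inversions_ext mul0n addn0.
Qed.

(** The last covector comes from b, where it already stands at the end, or from
    a, where it has to be moved past b. *)
Lemma slice1_wedge n (a b : form R (n + 1)) :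
  slice true (wedge a b) = wedge (slice false a) (slice true b)
    + wedge (slice true a) (grade_sign (slice false b)).
Proof.
apply/ffunP => S; rewrite !ffunE big_ext; congr (_ + _); apply: eq_bigr => T _.
  by rewrite !ffunE setD_ext inversions_ext mul0n addn0.
rewrite !ffunE setD_ext inversions_ext mul1n exprD /=; ring.
Qed.

Lemma sliceP n (a b : form R (n + 1)) :
  slice false a = slice false b -> slice true a = slice true b -> a = b.
Proof.
move=> h0 h1; apply/ffunP => T; rewrite (ext_surj T).
by case: (rshift n 0 \in T); [move/ffunP: h1|move/ffunP: h0];
  move=> /(_ [set j | lshift 1 j \in T]%SET); rewrite !ffunE.
Qed.

Lemma slice_is_linear n b : linear (@slice n b).
Proof. by move=> k x y; apply/ffunP => S; rewrite !ffunE. Qed.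
HB.instance Definition _ n b := GRing.isLinear.Build R[i] (form R (n + 1)) (form R n) _ (@slice n b) (@slice_is_linear n b).

Lemma wedge_linearl n (b : form R n) : linear (fun a => wedge a b).
Proof.
move=> k x y; apply/ffunP => S; rewrite !ffunE scaler_sumr -big_split /=.
by apply: eq_bigr => T _; rewrite !ffunE /GRing.scale /=; ring.
Qed.

Lemma wedge_linearr n (a : form R n) : linear (fun b => wedge a b).
Proof.
move=> k x y; apply/ffunP => S; rewrite !ffunE scaler_sumr -big_split /=.
by apply: eq_bigr => T _; rewrite !ffunE /GRing.scale /=; ring.
Qed.
HB.instance Definition _ n a := GRing.isLinear.Build R[i] (form R n) (form R n) _ (@wedge R n a) (@wedge_linearr n a).

Lemma wedge0l n (b : form R n) : wedge 0 b = 0.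
Proof. by have := wedge_linearl b (-1) 0 0; rewrite scaler0 addr0 scaleN1r addNr. Qed.

Lemma wedgeZl n k (x b : form R n) : wedge (k *: x) b = k *: wedge x b.
Proof. by have := wedge_linearl b k x 0; rewrite !addr0 wedge0l addr0. Qed.

Lemma wedge1r n (a : form R n) : wedge a (form1 n) = a.
Proof.
apply/ffunP => S; rewrite ffunE (bigD1 S) ?powersetE//= ffunE finset.setDv eqxx.
rewrite big1 ?addr0 => [|T /andP[]].
  rewrite inversionsE big1 ?mulr1 ?expr0 ?mul1r // => i _.
  by rewrite big1 // => j _; rewrite inE andbF.
rewrite powersetE => TS TnS; rewrite ffunE finset.setD_eq0.
by rewrite (_ : (S \subset T) = false) ?mulr0//; apply: contraNF TnS => ST; rewrite finset.eqEsubset TS.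
Qed.

Lemma homogeneous_wedge n k l (a b : form R n) :
  homogeneous k a -> homogeneous l b -> homogeneous (k + l) (wedge a b).
Proof.
move=> ha hb S hS; rewrite ffunE big1 // => T; rewrite powersetE => TS.
have [cT|/ha ->] := eqVneq #|T| k; last by rewrite mulr0 mul0r.
rewrite [b _]hb ?mulr0//; apply: contra hS => /eqP cD.
by rewrite -(cardsID T S) (finset.setIidPr TS) cT cD.
Qed.

Lemma homogeneousD n k (a b : form R n) :
  homogeneous k a -> homogeneous k b -> homogeneous k (a + b).
Proof. by move=> ha hb S hS; rewrite ffunE ha ?hb ?addr0. Qed.

Lemma homogeneous0 n k : homogeneous k (0 : form R n).
Proof. by move=> S _; rewrite ffunE. Qed.

Lemma homogeneousZ n k c (a : form R n) : homogeneous k a -> homogeneous k (c *: a).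
Proof. by move=> ha S hS; rewrite ffunE ha ?scaler0. Qed.

Lemma homogeneous_sum n k I (r : seq I) (P : pred I) (F : I -> form R n) :
  (forall i, P i -> homogeneous k (F i)) -> homogeneous k (\sum_(i <- r | P i) F i).
Proof.
move=> h; elim/big_rec: _ => [|i x Pi hx]; first exact: homogeneous0.
by apply: homogeneousD => //; exact: h.
Qed.

Lemma homogeneous_dx n (j : 'I_n) : homogeneous 1 (dx j : form R n).
Proof. by move=> S; rewrite ffunE; have [->|//] := eqVneq S [set j]%SET; rewrite cards1. Qed.

Lemma one_formP n (a b : form R n) : homogeneous 1 a -> homogeneous 1 b ->
  (forall k, a [set k]%SET = b [set k]%SET) -> a = b.
Proof.
move=> ha hb e; apply/ffunP => S.
have [/eqP/cards1P[k ->]//|h] := eqVneq #|S| 1%N.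
by rewrite ha ?hb.
Qed.

Lemma dx1 n (j k : 'I_n) : (dx j : form R n) [set k]%SET = (j == k)%:R.
Proof. by rewrite ffunE eq_sym (inj_eq finset.set1_inj). Qed.

Lemma sum_dx1 n (c : 'I_n -> R[i]) k :
  (\sum_j c j *: (dx j : form R n)) [set k]%SET = c k.
Proof.
rewrite form_sumE -[RHS](sum_pick c k); apply: eq_bigr => j _.
by rewrite form_scaleE dx1.
Qed.

Lemma homogeneous_sum_dx n (c : 'I_n -> R[i]) : homogeneous 1 (\sum_j c j *: (dx j : form R n)).
Proof. by apply: homogeneous_sum => j _; apply: homogeneousZ; exact: homogeneous_dx. Qed.

(** Only the singletons contribute, and for them the product over the index set
    has a single factor. *)
Lemma pull_one_form m n (L : 'M[R]_(m, n)) (a : form R m) : homogeneous 1 a ->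
  pull L a = \sum_k a [set k]%SET *: \sum_l (L k l)%:C *: dx l.
Proof.
move=> ha; rewrite /pull (bigID (fun S : {set 'I_m} => #|S| == 1%N)) /=.
rewrite [X in _ + X]big1 ?addr0; last by move=> S /ha ->; rewrite scale0r.
rewrite (eq_bigl (mem [set [set k] | k in 'I_m]%SET)); last first.
  by move=> S; apply/idP/imsetP => [/cards1P[k ->]|[k _ ->]]; [exists k|rewrite cards1].
rewrite big_imset /=; last by move=> ? ? _ _; apply: finset.set1_inj.
apply: eq_big => [k|k _]; first by [].
by rewrite finset.enum_set1 big_cons big_nil wedge1r.
Qed.

Lemma pull_one_formE m n (L : 'M[R]_(m, n)) (a : form R m) l : homogeneous 1 a ->
  pull L a [set l]%SET = \sum_k a [set k]%SET * (L k l)%:C.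
Proof.
move=> ha; rewrite pull_one_form // sum_ffunE; apply: eq_bigr => k _.
by rewrite ffunE sum_dx1.
Qed.

Lemma homogeneous_pull1 m n (L : 'M[R]_(m, n)) (a : form R m) :
  homogeneous 1 a -> homogeneous 1 (pull L a).
Proof.
move=> ha; rewrite pull_one_form //; apply: homogeneous_sum => k _.
by apply: homogeneousZ; exact: homogeneous_sum_dx.
Qed.

End Slices.

(** * Pull-back along the projection, and 2-forms as skew matrices *)

Section Cylinder.
Local Open Scope ring_scope.
Local Open Scope complex_scope.
Context {R : realType}.
Local Notation form := Defs.form.

Definition basis_form n (S : {set 'I_n}) : form R n := [ffun T => (T == S)%:R].

(** No inversions occur, since k precedes all of T. *)
Lemma wedge_dx_basis n (k : 'I_n) (T : {set 'I_n}) :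
  (forall t, t \in T -> (k < t)%N) ->
  wedge (dx k) (basis_form T) = basis_form (k |: T)%SET.
Proof.
move=> kT; have knT : k \notin T by apply/negP => /kT; rewrite ltnn.
apply/ffunP => S; rewrite !ffunE.
have [kS|knS] := boolP (k \in S); last first.
  rewrite big1 => [|U]; last first.
    rewrite powersetE => US; rewrite ffunE.
    case: eqVneq => [e|]; last by rewrite mulr0 mul0r.
    by move: US; rewrite e finset.sub1set (negPf knS).
  by case: eqVneq => // e; rewrite e !inE eqxx in knS.
rewrite (bigD1 [set k]%SET) /=; last by rewrite powersetE finset.sub1set.
rewrite big1 ?addr0 => [|U /andP[_ /negPf Uk]]; last by rewrite ffunE Uk mulr0 mul0r.
rewrite !ffunE eqxx mulr1.
have -> : (S :\: [set k] == T)%SET = (S == k |: T)%SET.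
  apply/eqP/eqP => [<-|->]; first by rewrite finset.setD1K.
  by rewrite finset.setU1K.
case: eqP => [->|]; last by rewrite mulr0.
rewrite finset.setU1K // inversionsE big1 ?expr0 ?mul1r// => i _.
rewrite big1 // => j _; rewrite inE; case: eqP => //= ->.
by case: (boolP (j \in T)) => //= /kT; rewrite ltnNge => /negPf h; rewrite ltnNge ltnW// ltnNge h.
Qed.

Lemma sorted_enum_set n (S : {set 'I_n}) : sorted (fun i j : 'I_n => (i < j)%N) (enum S).
Proof.
rewrite /enum_mem; apply: sorted_filter; first by move=> ? ? ?; apply: ltn_trans.
rewrite -enumT; have := iota_ltn_sorted 0 n; rewrite -val_enum_ord sorted_map.
exact.
Qed.

(** An increasing map of coordinates creates no signs, because index sets are
    enumerated in increasing order. *)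
Lemma big_wedge_dx m n (f : 'I_m -> 'I_n) (s : seq 'I_m) :
  {homo f : i j / (i < j)%N} -> sorted (fun i j : 'I_m => (i < j)%N) s ->
  \big[@wedge R n/form1 n]_(k <- s) dx (f k) = basis_form [set f k | k in s]%SET.
Proof.
move=> hf; elim: s => [|k s IH] /=.
  rewrite big_nil => _; apply/ffunP => T; rewrite !ffunE; congr ((_ == _)%:R).
  by apply/setP => x; rewrite inE; apply/esym/imsetP => -[].
move=> ks; rewrite big_cons IH; last by apply: path_sorted ks.
rewrite wedge_dx_basis.
  congr basis_form; apply/setP => x; rewrite !inE.
  apply/orP/imsetP => [[/eqP ->|/imsetP[y ys ->]]|[y]].
  - by exists k => //; rewrite mem_head.
  - by exists y => //; rewrite inE ys orbT.
  - by rewrite inE => /orP[/eqP ->|ys] ->; [left|right; apply/imsetP; exists y].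
move=> t /imsetP[y ys ->]; apply: hf.
move: ks => /order_path_min /allP; apply => //.
by move=> ? ? ?; apply: ltn_trans.
Qed.

Lemma pull_is_linear m n (L : 'M[R]_(m, n)) : linear (@pull R m n L).
Proof.
move=> k x y; rewrite /pull scaler_sumr -big_split /=; apply: eq_bigr => S _.
by rewrite !ffunE scalerDl scalerA.
Qed.
HB.instance Definition _ m n L := GRing.isLinear.Build R[i] (form R m) (form R n) _ (@pull R m n L) (@pull_is_linear m n L).

(** The pull-back along the projection that forgets the last coordinate. *)
Definition cyl n (a : form R n) : form R (n + 1) := pull (row_mx 1%:M 0) a.

Lemma cyl_is_linear n : linear (@cyl n).
Proof. exact: pull_is_linear. Qed.
HB.instance Definition _ n := GRing.isLinear.Build R[i] (form R n) (form R (n + 1)) _ (@cyl n) (@cyl_is_linear n).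

Lemma cylE n (a : form R n) : cyl a = \sum_S a S *: basis_form (ext false S).
Proof.
apply: eq_bigr => S _; congr (_ *: _).
transitivity (\big[@wedge R (n + 1)/form1 (n + 1)]_(k <- enum S) dx (lshift 1 k)).
  apply: eq_bigr => k _; rewrite big_split_ord /= big_ord1 row_mxEr mxE scale0r addr0.
  rewrite (bigD1 k) //= row_mxEl mxE eqxx scale1r big1 ?addr0// => j /negPf jk.
  by rewrite row_mxEl mxE eq_sym jk scale0r.
rewrite big_wedge_dx => [| |]; [|by []|exact: sorted_enum_set].
congr basis_form; apply/setP; elim/ord_addP => [j|]; rewrite ?in_ext_l ?in_ext_r.
  apply/imsetP/idP => [[k]|jS]; first by rewrite mem_enum => kS /lshift_inj ->.
  by exists j; rewrite ?mem_enum.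
by apply/imsetP => -[k _ /eqP]; rewrite eq_rlshift.
Qed.

Lemma cyl0E n (a : form R n) S : cyl a (ext false S) = a S.
Proof.
rewrite cylE form_sumE -[RHS](sum_pick a S); apply: eq_bigr => T _.
by rewrite form_scaleE [basis_form _ _]ffunE ext_inj eq_sym.
Qed.

Lemma cyl1E n (a : form R n) S : cyl a (ext true S) = 0.
Proof.
rewrite cylE form_sumE big1// => T _.
by rewrite form_scaleE [basis_form _ _]ffunE ext_inj mulr0.
Qed.

Lemma slice0_cyl n (a : form R n) : slice false (cyl a) = a.
Proof. by apply/ffunP => S; rewrite ffunE cyl0E. Qed.

Lemma slice1_cyl n (a : form R n) : slice true (cyl a) = 0.
Proof. by apply/ffunP => S; rewrite !ffunE cyl1E. Qed.

Lemma cyl_slice n (a : form R (n + 1)) : slice true a = 0 -> cyl (slice false a) = a.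
Proof. by move=> a1; apply: sliceP; rewrite ?slice0_cyl ?slice1_cyl. Qed.

Lemma cyl_wedge n (a b : form R n) : cyl (wedge a b) = wedge (cyl a) (cyl b).
Proof.
apply: sliceP; rewrite ?slice0_wedge ?slice1_wedge !slice0_cyl ?slice1_cyl//.
by rewrite wedge0l addr0 linear0.
Qed.

Lemma homogeneous_cyl n k (a : form R n) : homogeneous k a -> homogeneous k (cyl a).
Proof.
move=> ha S; rewrite (ext_surj S); case: (_ \in S) => h; first by rewrite cyl1E.
by rewrite cyl0E ha//; move: h; rewrite card_ext addn0.
Qed.

Lemma homogeneous_slice0 n k (a : form R (n + 1)) : homogeneous k a -> homogeneous k (slice false a).
Proof. by move=> ha S h; rewrite ffunE ha// card_ext addn0. Qed.

Lemma cyl_dx n (j : 'I_n) : cyl (dx j) = dx (lshift 1 j).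
Proof.
apply/ffunP => S; rewrite (ext_surj S) ffunE ext_set1l ext_inj.
by case: (_ \in S); rewrite ?cyl1E ?cyl0E ?ffunE.
Qed.

Lemma slice0_dxr n : slice false (dx (rshift n 0)) = 0 :> form R n.
Proof. by apply/ffunP => S; rewrite !ffunE ext_set1r ext_inj. Qed.

Lemma slice1_dxr n : slice true (dx (rshift n 0)) = form1 n :> form R n.
Proof. by apply/ffunP => S; rewrite !ffunE ext_set1r ext_inj. Qed.

Lemma Re_form_cyl n (a : form R n) : Re_form (cyl a) = cyl (Re_form a).
Proof.
apply/ffunP => S; rewrite (ext_surj S) ffunE.
by case: (_ \in S); rewrite ?cyl1E ?cyl0E ?ffunE.
Qed.

Lemma conj_form_cyl n (a : form R n) : conj_form (cyl a) = cyl (conj_form a).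
Proof.
apply/ffunP => S; rewrite (ext_surj S) ffunE.
by case: (_ \in S); rewrite ?cyl1E ?cyl0E ?ffunE// conjc0.
Qed.

(** The first summand has no component along the last covector and the second
    has no other, so they cannot cancel. *)
Lemma cyl_wedge_star n (F w Om : form R n) :
  wedge (cyl F) (2%:R^-1 *: wedge (cyl w) (cyl w)
                 - wedge (Re_form (cyl Om)) (dx (rshift n 0))) = 0 <->
  wedge F (wedge w w) = 0 /\ wedge F (Re_form Om) = 0.
Proof.
rewrite Re_form_cyl -cyl_wedge -linearZ.
set X := wedge _ _.
have X0 : slice false X = 2%:R^-1 *: wedge F (wedge w w).
  rewrite /X slice0_wedge linearB /= slice0_wedge slice0_dxr linear0 subr0.
  by rewrite !slice0_cyl linearZ.
have X1 : slice true X = - wedge F (Re_form Om).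
  rewrite /X slice1_wedge slice1_cyl wedge0l addr0 linearB /= slice1_cyl.
  rewrite slice1_wedge slice0_cyl slice1_dxr slice1_cyl wedge0l addr0 wedge1r.
  by rewrite slice0_cyl sub0r linearN.
split => [XE|[h0 h1]].
  split; last by apply/oppr_inj; rewrite -X1 XE oppr0 linear0.
  move: X0; rewrite XE linear0 => /esym/eqP; rewrite scaler_eq0 invr_eq0 pnatr_eq0 /=. by move/eqP.
apply: (@sliceP _ n X 0); first by rewrite X0 h0 scaler0 linear0.
by rewrite X1 h1 oppr0 linear0.
Qed.

Lemma wedge_set2 n (a b : form R n) (k l : 'I_n) : homogeneous 1 a -> homogeneous 1 b ->
  (k < l)%N -> wedge a b [set k; l]%SET =
    a [set k]%SET * b [set l]%SET - a [set l]%SET * b [set k]%SET.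
Proof.
move=> ha hb kl; have nkl : k != l by rewrite neq_ltn kl.
rewrite ffunE (bigD1 [set k]%SET) /=; last by rewrite powersetE finset.sub1set !inE eqxx.
rewrite (bigD1 [set l]%SET) /=; last first.
  by rewrite powersetE finset.sub1set !inE eqxx orbT (inj_eq finset.set1_inj) eq_sym.
rewrite big1 ?addr0 => [|T /andP[/andP[]]]; last first.
  rewrite powersetE => Tkl Tk Tl; rewrite ha ?mulr0 ?mul0r//.
  apply/negP => /cards1P[x xE]; move: Tkl Tk Tl.
  by rewrite xE finset.sub1set !inE !(inj_eq finset.set1_inj) => /orP[]->.
have -> : ([set k; l] :\: [set k] = [set l])%SET.
  by apply/setP => x; rewrite !inE; case: (eqVneq x k) => // ->; rewrite (negPf nkl).
have -> : ([set k; l] :\: [set l] = [set k])%SET.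
  by apply/setP => x; rewrite !inE; case: (eqVneq x l) => [->|]; rewrite ?orbF// eq_sym (negPf nkl).
have inv1 (x y : 'I_n) : inversions [set x]%SET [set y]%SET = (y < x)%N.
  rewrite inversionsE (bigD1 x) //= [X in (_ + X)%N]big1 ?addn0 => [|i /negPf ix]; last first.
    by rewrite big1 // => j _; rewrite inE ix.
  rewrite (bigD1 y) //= big1 ?addn0 => [|i /negPf ix]; last by rewrite !inE ix andbF.
  by rewrite !inE !eqxx.
by rewrite !inv1 kl ltnNge ltnW// expr0 expr1 !mul1r mulN1r mulNr.
Qed.

Lemma mx2_wedge n (a b : form R n) : homogeneous 1 a -> homogeneous 1 b ->
  mx2 (wedge a b) = \matrix_(k, l) (a [set k]%SET * b [set l]%SET - a [set l]%SET * b [set k]%SET).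
Proof.
move=> ha hb; apply/matrixP => k l; rewrite !mxE.
case: ltngtP => [kl|lk|/val_inj ->]; last by rewrite subrr.
  by rewrite wedge_set2.
by rewrite finset.setUC wedge_set2// opprB.
Qed.

Lemma mx2_is_linear n : linear (@mx2 R n).
Proof.
move=> c x y; apply/matrixP => k l; rewrite !mxE !ffunE.
case: ifP => // _; case: ifP => // _; last by rewrite mulr0 addr0.
by rewrite opprD -mulrN.
Qed.
HB.instance Definition _ n := GRing.isLinear.Build R[i] (form R n) 'M[R[i]]_n _ (@mx2 R n) (@mx2_is_linear n).

Lemma mx2_skew n (a : form R n) : (mx2 a)^T = - mx2 a.
Proof.
apply/matrixP => k l; rewrite !mxE.
by case: ltngtP => // [kl|lk|_]; rewrite ?oppr0 ?opprK// finset.setUC.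
Qed.

Lemma mx2_inj n (a b : form R n) : homogeneous 2 a -> homogeneous 2 b ->
  mx2 a = mx2 b -> a = b.
Proof.
move=> ha hb /matrixP e; apply/ffunP => S.
have [/cards2P[k [l [nkl ->]]]|h] := boolP (#|S| == 2%N); last by rewrite ha ?hb.
wlog kl : k l nkl / (k < l)%N.
  move=> H; case: (ltngtP k l) => [|lk|/val_inj/eqP]; [exact: H| |by rewrite (negPf nkl)].
  by rewrite finset.setUC; apply: H => //; rewrite eq_sym.
by have := e k l; rewrite !mxE kl.
Qed.

End Cylinder.

(** * Coefficients indexed by bit sequences *)

Section Bits.
Local Open Scope ring_scope.

(** The number n written as 0 + 1 + .. + 1, so that slicing a form in
    [addones n.+1] coordinates gives one in [addones n] coordinates by
    conversion. *)
Fixpoint addones n : nat := if n is n'.+1 then (addones n' + 1)%N else 0%N.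

(** The head of the sequence stands for the last index. *)
Fixpoint set_of_bits n (s : bitseq) : {set 'I_(addones n)} :=
  match n with
  | 0%N => finset.set0
  | n'.+1 => ext (head false s) (set_of_bits n' (behead s))
  end.

(** The recursion expressed by [slice0_wedge] and [slice1_wedge], as a program
    that runs on explicit bit sequences. *)
Fixpoint bit_wedge (K : pzRingType) (a b : bitseq -> K) (s : bitseq) : K :=
  match s with
  | [::] => a [::] * b [::]
  | c :: s' =>
    let a0 t := a (false :: t) in let b0 t := b (false :: t) in
    if c then
      bit_wedge a0 (fun t => b (true :: t)) s'
      + bit_wedge (fun t => a (true :: t))
          (fun t => if odd (count id t) then - b0 t else b0 t) s'
    else bit_wedge a0 b0 s'
  end.

(** Replaces the coefficients outside degree d, which are zero for homogeneous
    forms, by zeros that simplification can see. *)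
Definition degree_part (K : pzRingType) d (a : bitseq -> K) (t : bitseq) : K :=
  if eqn (count id t) d then a t else 0.

Lemma eq_bit_wedge (K : pzRingType) (a b a' b' : bitseq -> K) s :
  (forall t, size t = size s -> a t = a' t) ->
  (forall t, size t = size s -> b t = b' t) -> bit_wedge a b s = bit_wedge a' b' s.
Proof.
elim: s a b a' b' => [|c s IH] a b a' b' ha hb /=; first by rewrite ha ?hb.
have ea d t : size t = size s -> a (d :: t) = a' (d :: t) by move=> st; apply: ha; rewrite /= st.
have eb d t : size t = size s -> b (d :: t) = b' (d :: t) by move=> st; apply: hb; rewrite /= st.
case: c {ha hb}; last by apply: IH => t; [exact: ea|exact: eb].
congr (_ + _); apply: IH => t st; rewrite ?ea ?eb//.
Qed.

Section OnForms.
Context {R : realType}.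
Local Notation form := Defs.form.

Definition bits n (a : form R (addones n)) (t : bitseq) : R[i] := a (set_of_bits n t).

Lemma addonesE n : addones n = n.
Proof. by elim: n => //= n ->; rewrite addn1. Qed.

Lemma ltn_bits n (k : 'I_(addones n)) : (k < n)%N.
Proof. by apply: leq_trans (ltn_ord k) _; rewrite addonesE. Qed.

Lemma card_bits n s : size s = n -> #|set_of_bits n s| = count id s.
Proof.
elim: n s => [|n IH] [|c s] //=; first by rewrite finset.cards0.
by case=> /IH e; rewrite card_ext e addnC.
Qed.

Lemma bits_surj n (S : {set 'I_(addones n)}) : exists2 s, size s = n & S = set_of_bits n s.
Proof.
elim: n S => [|n IH] S; first by exists [::] => //; apply/setP => -[].
have [s ss e] := IH [set j | lshift 1 j \in S]%SET.
by exists ((rshift (addones n) 0 \in S) :: s); rewrite /= ?ss// -e -ext_surj.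
Qed.

Lemma mem_bits n s (k : 'I_(addones n)) : (k \in set_of_bits n s) = nth false s (n - k.+1).
Proof.
elim: n s k => [s []//|n IH s]; elim/ord_addP => [j|]; rewrite [X in _ \in X]/=.
  have jn := ltn_bits j.
  by rewrite in_ext_l IH subSS -(subnSK jn) nth_behead.
have -> : rshift (addones n) (0 : 'I_1) = n :> nat by rewrite -[RHS]addonesE; exact: addn0.
by rewrite in_ext_r subnn nth0.
Qed.

Lemma bits_wedge n (a b : form R (addones n)) s : size s = n ->
  bits (wedge a b) s = bit_wedge (bits a) (bits b) s.
Proof.
rewrite /bits; elim: n a b s => [|n IH] a b [|c s] // ss.
  rewrite /= ffunE finset.powerset0 big_set1 finset.setD0 inversionsE big1 ?expr0 ?mul1r//.
  by case.
have {}ss : size s = n by case: ss.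
pose sl := (@slice R (addones n)).
transitivity (sl c (wedge a b) (set_of_bits n s)); first by rewrite [RHS]ffunE.
have sE d (x : form R (addones n + 1)) t : sl d x (set_of_bits n t) = x (set_of_bits n.+1 (d :: t)).
  by rewrite ffunE.
case: c; rewrite /sl; last first.
  rewrite slice0_wedge IH //=; apply: eq_bit_wedge => t _; by rewrite ffunE.
rewrite slice1_wedge ffunE !IH //=; congr (_ + _); apply: eq_bit_wedge => t st; rewrite !ffunE//.
by rewrite card_bits ?st// -signr_odd; case: odd; rewrite ?mulN1r ?mul1r.
Qed.

Lemma bits_degree n d (a : form R (addones n)) t : homogeneous d a -> size t = n ->
  bits a t = degree_part d (bits a) t.
Proof.
move=> ha st; rewrite /degree_part; case: eqnP => // /eqP h.
by rewrite /bits ha// card_bits.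
Qed.

Definition pair_bits n (k l : nat) : bitseq :=
  mkseq (fun i => (n - i.+1 == k)%N || (n - i.+1 == l)%N) n.

Lemma pair_bitsE n (k l : 'I_(addones n)) : [set k; l]%SET = set_of_bits n (pair_bits n k l).
Proof.
apply/setP => j; rewrite mem_bits !inE.
have jn := ltn_bits j.
rewrite nth_mkseq; first by rewrite subnSK // subKn // ltnW.
by rewrite -subSn // subSS leq_subr.
Qed.

Lemma single_bitsE n (k : 'I_(addones n)) : [set k]%SET = set_of_bits n (pair_bits n k k).
Proof. by rewrite -pair_bitsE finset.setUid. Qed.

Lemma set_of_bits_inj n s t : size s = n -> size t = n ->
  set_of_bits n s = set_of_bits n t -> s = t.
Proof.
elim: n s t => [|n IH] [|c s] [|d t] //= [ss] [st] /eqP.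
by rewrite ext_inj => /andP[/eqP -> /eqP /IH ->].
Qed.

Lemma bits_dx n (k : 'I_(addones n)) t : size t = n -> bits (dx k) t = (t == pair_bits n k k)%:R.
Proof.
move=> st; rewrite /bits ffunE single_bitsE; congr (_%:R); congr nat_of_bool.
apply/eqP/eqP => [|->//]; apply: set_of_bits_inj => //; exact: size_mkseq.
Qed.

End OnForms.
End Bits.

(** * The Pfaffian in dimension six *)

Section Pfaffian6.
Local Open Scope ring_scope.
Variable K : comPzRingType.
Implicit Types a w : bitseq -> K.

Definition full_bits : bitseq := nseq 6 true.

Definition bits_mx a (k l : nat) : K :=
  if (k < l)%N then a (pair_bits 6 k l)
  else if (l < k)%N then - a (pair_bits 6 l k) else 0.

(** Twice the cofactors of the Pfaffian of the skew matrix of w: its signed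
    4 x 4 sub-Pfaffians are half the coefficients of w /\ w. *)
Definition pf_cofactor w (k l : nat) : K :=
  let cof i j := (-1) ^+ i * (-1) ^+ j.+1 * bit_wedge w w (map negb (pair_bits 6 i j)) in
  if (k < l)%N then cof k l else if (l < k)%N then - cof l k else 0.

Lemma sum6 (f : 'I_6 -> K) : \sum_k f k =
  f (inord 0) + f (inord 1) + f (inord 2) + f (inord 3) + f (inord 4) + f (inord 5).
Proof.
rewrite !big_ord_recl big_ord0 addr0 !addrA.
by do ![congr (_ + _)|congr f]; apply: val_inj; rewrite /= inordK.
Qed.

(** Up to a factor, both sides are the derivative of the Pfaffian at w in the
    direction a. *)
Lemma pf_cofactor_expand a w : let a2 := degree_part 2 a in let w2 := degree_part 2 w in
  \sum_(k < 6) \sum_(l < 6) pf_cofactor w2 k l * bits_mx a2 k l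
  = 2%:R * bit_wedge a2 (bit_wedge w2 w2) full_bits.
Proof.
move=> a2 w2; rewrite !sum6 /pf_cofactor /bits_mx !inordK //.
rewrite /a2 /w2 /= /pair_bits /degree_part /=.
ring.
Qed.

(** Row expansion of the Pfaffian: the off-diagonal entries are Pfaffians with
    a repeated row. *)
Lemma pf_cofactor_mul w (k m : 'I_6) : let w2 := degree_part 2 w in
  3%:R * (\sum_(l < 6) bits_mx w2 k l * pf_cofactor w2 m l) =
  (k == m)%:R * bit_wedge w2 (bit_wedge w2 w2) full_bits.
Proof.
move=> w2; rewrite !sum6 !inordK // -val_eqE.
(* The cube is expanded once here, not in each of the 36 cases. *)
have -> : bit_wedge w2 (bit_wedge w2 w2) full_bits =
    3%:R * (\sum_(l < 6) bits_mx w2 (@ord0 5) l * pf_cofactor w2 (@ord0 5) l).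
  rewrite sum6 !inordK // /pf_cofactor /bits_mx /w2 /= /pair_bits /degree_part /=.
  ring.
rewrite sum6 !inordK //; case: k m => [i hi] [j hj] /=.
case: i hi => [|[|[|[|[|[|//]]]]]] _; case: j hj => [|[|[|[|[|[|//]]]]]] _;
 rewrite /pf_cofactor /bits_mx /w2 /= /pair_bits /degree_part /=.
all: ring.
Qed.
End Pfaffian6.

(** * Products with the complex volume form in coordinates *)

Section VolumeForm6.
Local Open Scope ring_scope.

Definition dz_bits (K : pzRingType) (J : K) k (t : bitseq) : K :=
  (t == pair_bits 6 k k)%:R + J * (t == pair_bits 6 k.+3 k.+3)%:R.

(** The product dz_1 /\ dz_2 /\ dz_3 selects dx_k or J dy_k for each k; the
    signs come from sorting the dy's behind the dx's.  J is the imaginary unit or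
    its opposite, for the conjugate form. *)
Definition vol_bits (K : pzRingType) (J : K) (t : bitseq) : K :=
  match t with
  | [:: y3; y2; y1; x3; x2; x1] =>
    if [&& x1 (+) y1, x2 (+) y2 & x3 (+) y3] then
      (-1) ^+ (y1 && x2) * (-1) ^+ (y1 && x3) * (-1) ^+ (y2 && x3)
      * (J ^+ y1 * J ^+ y2 * J ^+ y3)
    else 0
  | _ => 0
  end.

Lemma vol_bitsE (K : comPzRingType) (J : K) t : size t = 6 ->
  degree_part 3 (bit_wedge (bit_wedge (dz_bits J 0) (dz_bits J 1)) (dz_bits J 2)) t
  = degree_part 3 (vol_bits J) t.
Proof.
case: t => [|b1[|b2[|b3[|b4[|b5[|b6[|//]]]]]]] // _.
by case: b1; case: b2; case: b3; case: b4; case: b5; case: b6;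
   rewrite // /degree_part /= /dz_bits /=; ring.
Qed.

Section Vol.
Variables (K : fieldType) (J f g : K) (a : bitseq -> K).
Hypothesis JJ : J * J = -1.
Let a2 := degree_part 2 a.
Let v := degree_part 3 (fun t => f * vol_bits J t + g * vol_bits (- J) t).

Definition hole_bits m : bitseq := mkseq (fun i => (5 - i)%N != m) 6.

(** The two complex coordinates other than m. *)
Definition other_pair (m : nat) : nat * nat :=
  match m with 0 => (1, 2) | 1 => (0, 2) | _ => (0, 1) end%N.

(** For J the imaginary unit, the components of a of type (0,2) and (2,0) in the
    two coordinates other than m are multiples of [xx_yy + J xy_yx] and
    [xx_yy - J xy_yx]. *)
Definition xx_yy m : K := let: (k, l) := other_pair m in
  a2 (pair_bits 6 k l) - a2 (pair_bits 6 k.+3 l.+3).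
Definition xy_yx m : K := let: (k, l) := other_pair m in
  a2 (pair_bits 6 k l.+3) - a2 (pair_bits 6 l k.+3).

(** A product of degree five that misses x_m or y_m pairs the volume form with
    the remaining two complex coordinates of a.  The missing coordinate decides
    the relative sign of the (0,2)-term and the (2,0)-term. *)
Lemma bit_wedge_hole m : (m < 3)%N ->
  let p := f * (xx_yy m + J * xy_yx m) in let q := g * (xx_yy m - J * xy_yx m) in
  bit_wedge a2 v (hole_bits m) = - (J * (p - q)) /\ bit_wedge a2 v (hole_bits m.+3) = - (p + q).
Proof.
case: m => [|[|[|//]]] _; rewrite /xx_yy /xy_yx; split;
  rewrite /v /a2 /hole_bits /= /pair_bits /degree_part /= /mkseq /=; ring: JJ.
Qed.

Lemma hole_bitsP t : size t = 6 -> count id t = 5 ->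
  exists2 m, (m < 3)%N & t = hole_bits m \/ t = hole_bits m.+3.
Proof.
case: t => [|b1[|b2[|b3[|b4[|b5[|b6[|//]]]]]]] // _.
by case: b1; case: b2; case: b3; case: b4; case: b5; case: b6 => //= _;
  [exists 0%N|exists 1%N|exists 2%N|exists 0%N|exists 1%N|exists 2%N]; auto.
Qed.

(** The two relative signs of [bit_wedge_hole] force both terms to vanish. *)
Lemma bit_wedge_vol : (2%:R : K) != 0 -> f != 0 -> g != 0 ->
  (forall t, size t = 6 -> count id t = 5 -> bit_wedge a2 v t = 0) <->
  (forall m, (m < 3)%N -> xx_yy m = 0 /\ xy_yx m = 0).
Proof.
move=> two f0 g0.
have z2 (x : K) : x + x = 0 -> x = 0.
  by move/eqP; rewrite -mulr2n -mulr_natl mulf_eq0 (negPf two) => /eqP.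
have J0 : J != 0 by apply/negP => /eqP e; move/eqP: JJ; rewrite e mul0r eq_sym oppr_eq0 oner_eq0.
split=> [H m m3|H t st ct].
  have [/esym/eqP e1 /esym/eqP e2] := bit_wedge_hole m3.
  have z1 : bit_wedge a2 v (hole_bits m) = 0.
    by apply: H; [exact: size_mkseq|case: m m3 {e1 e2} => [|[|[|]]]].
  have z3 : bit_wedge a2 v (hole_bits m.+3) = 0.
    by apply: H; [exact: size_mkseq|case: m m3 {e1 e2 z1} => [|[|[|]]]].
  rewrite z1 oppr_eq0 mulf_eq0 (negPf J0) /= in e1.
  rewrite z3 oppr_eq0 in e2.
  move: e1 e2; set u := xx_yy m; set w := xy_yx m; rewrite subr_eq0 addr_eq0 => /eqP e1 /eqP e2.
  have h1 : u + J * w = 0.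
    have /eqP : f * (u + J * w) = 0 by apply: z2; rewrite {1}e1 e2 subrr.
    by rewrite mulf_eq0 (negPf f0) => /eqP.
  have h2 : u - J * w = 0.
    have /eqP : g * (u - J * w) = 0 by rewrite -e1 h1 mulr0.
    by rewrite mulf_eq0 (negPf g0) => /eqP.
  split; first by apply: z2; rewrite -[RHS](addr0 0) -{1}h1 -h2; ring.
  apply: z2; have -> : w + w = 2%:R * (1 + J * J) * w - J * ((u + J * w) - (u - J * w)) by ring.
  by rewrite h1 h2 JJ; ring.
have [m m3] := hole_bitsP st ct; have [h1 h2] := H m m3.
have [e1 e2] := bit_wedge_hole m3.
by case=> ->; rewrite ?e1 ?e2 h1 h2; ring.
Qed.
End Vol.
End VolumeForm6.

(** * Forms of type (1,1) *)

Section Type11Coefficients.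
Local Open Scope ring_scope.
Variables (K : fieldType) (J : K).
Hypotheses (JJ : J * J = -1).

Lemma wedge_dz_yy (c a b d e : K) : c * (J * a * (- J * b) - J * d * (- J * e)) = c * (a * b) - c * (d * e).
Proof. ring: JJ. Qed.

Lemma wedge_dz_xy (c a b d e : K) : c * (a * (- J * b) - J * d * e) = - J * (c * (a * b) + c * (d * e)).
Proof. ring. Qed.

Hypothesis two : (2%:R : K) != 0.
Lemma type11_coef_re (x y : K) : 2%:R^-1 * (x + J * y) - 2%:R^-1 * (- x + J * y) = x.
Proof. by field. Qed.

Lemma type11_coef_im (x y : K) : - J * (2%:R^-1 * (x + J * y) + 2%:R^-1 * (- x + J * y)) = y.
Proof.
have -> : - J * (2%:R^-1 * (x + J * y) + 2%:R^-1 * (- x + J * y)) = - (J * J) * y by field.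
by rewrite JJ opprK mul1r.
Qed.
End Type11Coefficients.

Section Hermitian.
Local Open Scope ring_scope.
Local Open Scope complex_scope.
Context {R : realType}.
Local Notation form := Defs.form.

Lemma sqr_im : 'i * 'i = -1 :> R[i].
Proof. by rewrite -expr2 sqr_i. Qed.

Lemma conjc_im : conjc 'i = - 'i :> R[i].
Proof. by apply/eqP; rewrite eq_complex /= oppr0 !eqxx. Qed.

(** The condition a(Jv, Jw) = a(v, w) on coordinate vectors. *)
Definition J_invariant n (a : form R (n + n)) := forall p q : 'I_n,
  mx2 a (lshift n p) (lshift n q) = mx2 a (rshift n p) (rshift n q) /\
  mx2 a (lshift n p) (rshift n q) = mx2 a (lshift n q) (rshift n p).

Lemma homogeneous_dz n (k : 'I_n) : homogeneous 1 (dz k : form R (n + n)).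
Proof.
apply: homogeneousD; first exact: homogeneous_dx.
by apply: homogeneousZ; exact: homogeneous_dx.
Qed.

Lemma homogeneous_conj n k (a : form R n) : homogeneous k a -> homogeneous k (conj_form a).
Proof. by move=> ha S hS; rewrite ffunE ha ?conjc0. Qed.

Lemma dzl n (k p : 'I_n) : (dz k : form R (n + n)) [set lshift n p]%SET = (k == p)%:R.
Proof.
rewrite ffunE dx1 [X in _ + X]ffunE dx1 (inj_eq (@lshift_inj _ _)) eq_rlshift.
by rewrite scaler0 addr0.
Qed.

Lemma dzr n (k p : 'I_n) : (dz k : form R (n + n)) [set rshift n p]%SET = 'i * (k == p)%:R.
Proof.
by rewrite ffunE dx1 [X in _ + X]ffunE dx1 (inj_eq (@rshift_inj _ _)) eq_lrshift add0r.
Qed.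

Lemma dzl_conj n (k p : 'I_n) : conjc ((dz k : form R (n + n)) [set lshift n p]%SET) = (k == p)%:R.
Proof. by rewrite dzl; case: eqP => _; [exact: conjc1|exact: conjc0]. Qed.

Lemma dzr_conj n (k p : 'I_n) :
  conjc ((dz k : form R (n + n)) [set rshift n p]%SET) = - 'i * (k == p)%:R.
Proof.
rewrite dzr; case: eqP => _; last by rewrite !mulr0; exact: conjc0.
by rewrite !mulr1; exact: conjc_im.
Qed.

Lemma sum_pick2 n (c : 'I_n -> 'I_n -> R[i]) p q :
  \sum_k \sum_l c k l * ((k == p)%:R * (l == q)%:R) = c p q.
Proof.
rewrite (bigD1 p) //= (bigD1 q) //= !eqxx !mulr1 !big1 ?addr0 // => [k /negPf kp|l /negPf lq].
  by rewrite big1 // => l _; rewrite kp mul0r mulr0.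
by rewrite lq !mulr0.
Qed.

Lemma conj_formE n (a : form R n) S : conj_form a S = conjc (a S).
Proof. exact: ffunE. Qed.

Section Type11.
Variables (n : nat) (c : 'I_n -> 'I_n -> R[i]).
Let S := \sum_k \sum_l c k l *: wedge (dz k) (conj_form (dz l)) : form R (n + n).

Lemma mx2_type11 x y :
  mx2 S x y = \sum_k \sum_l c k l *
    ((dz k : form R _) [set x]%SET * conjc ((dz l : form R _) [set y]%SET)
     - (dz k : form R _) [set y]%SET * conjc ((dz l : form R _) [set x]%SET)).
Proof.
rewrite /S linear_sum summxE; apply: eq_bigr => k _.
rewrite linear_sum summxE; apply: eq_bigr => l _.
rewrite linearZ /= mx2_wedge; last 2 first.
- exact: homogeneous_dz.
- by apply: homogeneous_conj; exact: homogeneous_dz.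
by rewrite mxE [X in _ * X]mxE !conj_formE.
Qed.

Lemma mx2_type11_xx p q : mx2 S (lshift n p) (lshift n q) = c p q - c q p.
Proof.
rewrite mx2_type11 -[in RHS](sum_pick2 c p q) -[c q p](sum_pick2 c q p).
rewrite -sumrB; apply: eq_bigr => k _; rewrite -sumrB; apply: eq_bigr => l _.
by rewrite !dzl_conj !dzl mulrBr.
Qed.

Lemma mx2_type11_yy p q : mx2 S (rshift n p) (rshift n q) = c p q - c q p.
Proof.
rewrite mx2_type11 -[in RHS](sum_pick2 c p q) -[c q p](sum_pick2 c q p).
rewrite -sumrB; apply: eq_bigr => k _; rewrite -sumrB; apply: eq_bigr => l _.
rewrite !dzr_conj !dzr; exact: (wedge_dz_yy sqr_im).
Qed.

Lemma mx2_type11_xy p q : mx2 S (lshift n p) (rshift n q) = - 'i * (c p q + c q p).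
Proof.
rewrite mx2_type11 -[in RHS](sum_pick2 c p q) -[c q p](sum_pick2 c q p).
rewrite -big_split /= mulr_sumr; apply: eq_bigr => k _.
rewrite -big_split /= mulr_sumr; apply: eq_bigr => l _.
rewrite dzr_conj dzl_conj dzl dzr; exact: wedge_dz_xy.
Qed.

End Type11.

(** Both covectors of each generator are eigenvectors of J, with inverse
    eigenvalues; conversely J-invariance lets the coefficients be read off the
    matrix of a. *)
Lemma type11P n (a : form R (n + n)) : homogeneous 2 a ->
  type11 a <-> J_invariant a.
Proof.
move=> ha; split=> [[c ->] p q|inv].
  by rewrite mx2_type11_xx mx2_type11_yy !mx2_type11_xy [c q p + _]addrC.
pose M := mx2 a.
(* The value of a on d/dz_k and d/dzbar_l, simplified by J-invariance. *)
pose c k l := 2%:R^-1 * (M (lshift n k) (lshift n l) + 'i * M (lshift n k) (rshift n l)).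
have two : (2%:R : R[i]) != 0 by rewrite pnatr_eq0.
have skew x y : M y x = - M x y.
  by have /matrixP/(_ x y) := mx2_skew a; rewrite !mxE.
have xx p q : c p q - c q p = M (lshift n p) (lshift n q).
  rewrite /c (skew (lshift n p) (lshift n q)) /M (inv q p).2; exact: (type11_coef_re _ two).
have xy p q : - 'i * (c p q + c q p) = M (lshift n p) (rshift n q).
  rewrite /c (skew (lshift n p) (lshift n q)) /M (inv q p).2.
  exact: (type11_coef_im sqr_im two).
exists c; apply: mx2_inj => //.
  apply: homogeneous_sum => k _; apply: homogeneous_sum => l _; apply: homogeneousZ.
  apply: (@homogeneous_wedge _ _ 1 1); first exact: homogeneous_dz.
  by apply: homogeneous_conj; exact: homogeneous_dz.
set S := \sum_k _.
have skewS x y : mx2 S y x = - mx2 S x y.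
  by have /matrixP/(_ x y) := mx2_skew S; rewrite !mxE.
apply/matrixP => x y; rewrite -(splitK x) -(splitK y).
case: (fintype.split x) => p; case: (fintype.split y) => q /=.
- by rewrite mx2_type11_xx xx.
- by rewrite mx2_type11_xy xy.
- by rewrite skewS mx2_type11_xy xy skew opprK.
- by rewrite mx2_type11_yy xx /M (inv p q).1.
Qed.

End Hermitian.

(** * The wedge product with the real part of the volume form *)

(** Applied to conjugation, this gives the coefficients of the conjugate volume
    form. *)
Lemma rmorph_vol_bits (K L : pzRingType) (s : {rmorphism K -> L}) (J : K) t :
  s (vol_bits J t) = vol_bits (s J) t.
Proof.
case: t => [|b1[|b2[|b3[|b4[|b5[|b6[|? ?]]]]]]]; rewrite /vol_bits ?rmorph0 //.
case: (_ && _); last exact: rmorph0.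
by rewrite !rmorphM !rmorphXn rmorphN1.
Qed.

Lemma vol_conj_bits (K : comPzRingType) (J : K) : (J * J = -1)%R ->
  bit_wedge (degree_part 3 (vol_bits J)) (degree_part 3 (vol_bits (- J)%R)) full_bits = (8%:R * J)%R.
Proof. move=> JJ; rewrite /= /degree_part /=; ring: JJ. Qed.

Section CalabiYauAlgebra.
Local Open Scope ring_scope.
Local Open Scope complex_scope.
Context {R : realType}.
Local Notation form := Defs.form.
Local Notation form6 := (form R (3 + 3)).

Definition bits6 (a : form6) : bitseq -> R[i] := @bits R 6 a.
Definition vol : form6 := wedge (wedge (dz (0 : 'I_3)) (dz (1 : 'I_3))) (dz (2%:R : 'I_3)).

Lemma bits6_wedge (a b : form6) t : size t = 6 ->
  bits6 (wedge a b) t = bit_wedge (bits6 a) (bits6 b) t.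
Proof. exact: (@bits_wedge R 6 a b t). Qed.

Lemma bits6_degree d (a : form6) t : homogeneous d a -> size t = 6 ->
  bits6 a t = degree_part d (bits6 a) t.
Proof. exact: (@bits_degree R 6 d a t). Qed.

Lemma bits6_surj (S : {set 'I_(3 + 3)}) : exists2 s, size s = 6 & S = set_of_bits 6 s.
Proof. exact: (@bits_surj 6 S). Qed.

Lemma bits6_full (a : form6) : a [set: 'I_(3 + 3)]%SET = bits6 a full_bits.
Proof.
rewrite /bits6 /bits; congr (a _); apply/setP => j.
have := @mem_bits 6 full_bits j; rewrite nth_nseq => ->.
by rewrite inE; case: (j : nat) (ltn_ord j) => [|[|[|[|[|[|]]]]]].
Qed.

Lemma bits6_dz (k : 'I_3) t : size t = 6 -> bits6 (dz k) t = dz_bits 'i k t.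
Proof.
move=> st; rewrite /bits6 /bits /dz ffunE [X in _ + X]ffunE.
have := @bits_dx R 6 (lshift 3 k) t st; rewrite /bits => ->.
by have := @bits_dx R 6 (rshift 3 k) t st; rewrite /bits => ->.
Qed.

Lemma bits6_vol t : size t = 6 -> bits6 vol t = degree_part 3 (vol_bits 'i) t.
Proof.
move=> st; have hv : homogeneous 3 vol.
  by apply: (@homogeneous_wedge _ _ 2 1); [apply: (@homogeneous_wedge _ _ 1 1)|]; exact: homogeneous_dz.
rewrite (bits6_degree hv) // -vol_bitsE // /degree_part; congr (if _ then _ else _).
rewrite bits6_wedge //; apply: eq_bit_wedge => u su; last by rewrite bits6_dz ?su.
by rewrite bits6_wedge ?su //; apply: eq_bit_wedge => x sx; rewrite bits6_dz ?sx ?su.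
Qed.

Lemma conjc_vol_bits t : conjc (vol_bits 'i t) = vol_bits (- 'i) t :> R[i].
Proof. by rewrite -conjc_im; exact: rmorph_vol_bits. Qed.

Lemma Re_average (z : R[i]) : (complex.Re z)%:C = 2%:R^-1 * (z + conjc z).
Proof.
case: z => x y; apply: (mulfI (_ : (2%:R : R[i]) != 0)); first by rewrite pnatr_eq0.
rewrite mulrA mulfV ?pnatr_eq0// mul1r mulr_natl mulr2n.
by apply/eqP; rewrite eq_complex /= addr0 subrr !eqxx.
Qed.

Lemma homogeneous_Re n k (a : form R n) : homogeneous k a -> homogeneous k (Re_form a).
Proof. by move=> ha S hS; rewrite ffunE ha. Qed.

Lemma homogeneous_vol : homogeneous 3 vol.
Proof.
by apply: (@homogeneous_wedge _ _ 2 1); [apply: (@homogeneous_wedge _ _ 1 1)|]; exact: homogeneous_dz.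
Qed.

Lemma bits6_ReZ_vol f t : size t = 6 -> bits6 (Re_form (f *: vol)) t =
  degree_part 3 (fun t => (2%:R^-1 * f) * vol_bits 'i t + (2%:R^-1 * conjc f) * vol_bits (- 'i) t) t.
Proof.
move=> st; rewrite /bits6 /bits ffunE [(f *: vol) _]ffunE.
have := bits6_vol st; rewrite /bits6 /bits => ->; rewrite /degree_part.
case: eqn; last by rewrite scaler0.
rewrite Re_average -conjc_vol_bits -!mulrA -mulrDr; congr (_ * (_ + _)).
exact: rmorphM.
Qed.

Lemma mx2_bits (a : form6) (k l : 'I_(3 + 3)) : (k < l)%N ->
  mx2 a k l = bits6 a (pair_bits 6 k l).
Proof. by move=> kl; rewrite mxE kl /bits6 /bits -(@pair_bitsE 6 k l). Qed.

Lemma J_invariant_bits (F : form6) : homogeneous 2 F ->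
  J_invariant F <-> (forall m, (m < 3)%N -> xx_yy (bits6 F) m = 0 /\ xy_yx (bits6 F) m = 0).
Proof.
move=> hF.
have skew x y : mx2 F y x = - mx2 F x y.
  by have /matrixP/(_ x y) := mx2_skew F; rewrite !mxE.
have E (p q : 'I_3) : (p < q)%N ->
   (mx2 F (lshift 3 p) (lshift 3 q) = mx2 F (rshift 3 p) (rshift 3 q) /\
    mx2 F (lshift 3 p) (rshift 3 q) = mx2 F (lshift 3 q) (rshift 3 p)) <->
   (degree_part 2 (bits6 F) (pair_bits 6 p q) - degree_part 2 (bits6 F) (pair_bits 6 p.+3 q.+3) = 0 /\
    degree_part 2 (bits6 F) (pair_bits 6 p q.+3) - degree_part 2 (bits6 F) (pair_bits 6 q p.+3) = 0).
  move=> pq; rewrite -!bits6_degree ?size_mkseq //.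
  have lr (i j : 'I_3) : (lshift 3 i < rshift 3 j)%N by rewrite /= ltn_addr.
  rewrite !mx2_bits ?lr //=.
  by split=> -[/eqP e1 /eqP e2]; split; apply/eqP; rewrite ?subr_eq0// -subr_eq0.
have o (p q : nat) (p3 : (p < 3)%N) (q3 : (q < 3)%N) : (p < q)%N -> _ := E (Ordinal p3) (Ordinal q3).
split=> [inv [|[|[|//]]] _|H].
- exact: ((o 1 2 isT isT isT)%N.1 (inv _ _)).
- exact: ((o 0 2 isT isT isT)%N.1 (inv _ _)).
- exact: ((o 0 1 isT isT isT)%N.1 (inv _ _)).
have main (p q : 'I_3) : (p < q)%N ->
   mx2 F (lshift 3 p) (lshift 3 q) = mx2 F (rshift 3 p) (rshift 3 q) /\
    mx2 F (lshift 3 p) (rshift 3 q) = mx2 F (lshift 3 q) (rshift 3 p).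
  move=> pq; apply/(E _ _ pq).
  case: p q pq => [[|[|[|//]]] p3] [[|[|[|//]]] q3] //= _; [exact: (H 2%N)|exact: (H 1%N)|exact: (H 0%N)].
move=> p q; case: (ltngtP p q) => [/main //|/main[e1 e2]|/val_inj ->].
  by rewrite skew e1 -skew e2.
split=> //; move: (skew (lshift 3 q) (lshift 3 q)) (skew (rshift 3 q) (rshift 3 q)).
by rewrite !mxE !ltnn.
Qed.

(** F /\ Om has type (3,2) and sees the (0,2)-component of F only, while
    F /\ conj Om has type (2,3) and sees the (2,0)-component only. *)
Lemma wedge_Re_vol (F : form6) (f : R[i]) : homogeneous 2 F -> f != 0 ->
  wedge F (Re_form (f *: vol)) = 0 <-> type11 F.
Proof.
move=> hF f0; have two : (2%:R : R[i]) != 0 by rewrite pnatr_eq0.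
have g0 : 2%:R^-1 * f != 0 by rewrite mulf_neq0 ?invr_eq0.
have h0 : 2%:R^-1 * conjc f != 0.
  by rewrite mulf_neq0 ?invr_eq0// fmorph_eq0.
have hO : homogeneous 3 (Re_form (f *: vol)).
  by apply: homogeneous_Re; apply: homogeneousZ; exact: homogeneous_vol.
have hW := homogeneous_wedge hF hO.
rewrite (type11P hF) (J_invariant_bits hF) -(bit_wedge_vol (bits6 F) sqr_im two g0 h0).
have E t : size t = 6 -> bits6 (wedge F (Re_form (f *: vol))) t = bit_wedge (degree_part 2 (bits6 F))
    (degree_part 3 (fun t => (2%:R^-1 * f) * vol_bits 'i t + (2%:R^-1 * conjc f) * vol_bits (- 'i) t)) t.
  move=> st; rewrite bits6_wedge //; apply: eq_bit_wedge => u; rewrite st => su.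
    exact: bits6_degree.
  exact: bits6_ReZ_vol.
split=> [W0 t st _|H]; first by rewrite -E // W0 /bits6 /bits ffunE.
apply/ffunP => S; rewrite [RHS]ffunE; have [s ss ->] := bits6_surj S.
rewrite -[LHS]/(bits6 _ s).
have [c5|c5] := eqVneq (count id s) 5; first by rewrite E // H.
by rewrite /bits6 /bits hW // (@card_bits 6).
Qed.

Lemma wedge_vol_conj : (wedge vol (conj_form vol)) [set: 'I_(3 + 3)]%SET != 0.
Proof.
have -> : wedge vol (conj_form vol) [set: 'I_(3 + 3)]%SET =
   bit_wedge (degree_part 3 (vol_bits 'i)) (degree_part 3 (vol_bits (- 'i))) full_bits.
  rewrite bits6_full bits6_wedge //; apply: eq_bit_wedge => t st.
    exact: bits6_vol.
  rewrite /bits6 /bits conj_formE.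
  have := bits6_vol st; rewrite /bits6 /bits => ->; rewrite /degree_part.
  by case: eqn; [exact: conjc_vol_bits|exact: conjc0].
rewrite (vol_conj_bits sqr_im).
by rewrite mulf_neq0 ?pnatr_eq0// -sqrf_eq0 sqr_i oppr_eq0 oner_eq0.
Qed.

End CalabiYauAlgebra.

(** * The wedge product with the square of the Kahler form *)

Section Pfaffian.
Local Open Scope ring_scope.
Local Open Scope complex_scope.
Context {R : realType}.
Local Notation form := Defs.form.
Local Notation form6 := (form R (3 + 3)).

Lemma mx2_bits_mx (a : form6) (k l : 'I_(3 + 3)) : homogeneous 2 a ->
  mx2 a k l = bits_mx (degree_part 2 (bits6 a)) k l.
Proof.
move=> ha; rewrite /bits_mx -!bits6_degree ?size_mkseq //.
case: ltngtP => [kl|lk|/val_inj ->].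
- exact: mx2_bits.
- by rewrite -mx2_bits //; have /matrixP/(_ l k) := mx2_skew a; rewrite !mxE.
- by rewrite mxE ltnn.
Qed.

Lemma bit_wedge_cube (K : comPzRingType) (w : bitseq -> K) : let w2 := degree_part 2 w in
  bit_wedge (bit_wedge w2 w2) w2 full_bits = bit_wedge w2 (bit_wedge w2 w2) full_bits.
Proof. move=> w2; rewrite /w2 /= /degree_part /=; ring. Qed.

Lemma bits6_top (a w : form6) : homogeneous 2 a -> homogeneous 2 w ->
  (wedge a (wedge w w)) [set: 'I_(3 + 3)]%SET =
  bit_wedge (degree_part 2 (bits6 a))
    (bit_wedge (degree_part 2 (bits6 w)) (degree_part 2 (bits6 w))) full_bits.
Proof.
move=> ha hw; rewrite bits6_full bits6_wedge //; apply: eq_bit_wedge => t st.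
  exact: bits6_degree.
by rewrite bits6_wedge //; apply: eq_bit_wedge => u su; apply: bits6_degree => //; rewrite su.
Qed.

Lemma bits6_cube (w : form6) : homogeneous 2 w ->
  (wedge (wedge w w) w) [set: 'I_(3 + 3)]%SET = (wedge w (wedge w w)) [set: 'I_(3 + 3)]%SET.
Proof.
move=> hw; rewrite bits6_top // -bit_wedge_cube bits6_full bits6_wedge //.
apply: eq_bit_wedge => t st; last exact: bits6_degree.
by rewrite bits6_wedge //; apply: eq_bit_wedge => u su; apply: bits6_degree => //; rewrite su.
Qed.

Lemma Jmx_sqr n : Jmx n *m Jmx n = - 1%:M :> 'M[R[i]]_(n + n).
Proof.
rewrite /Jmx mulmx_block !mulmx0 !mul0mx !mul1mx !mulmx1 !add0r !addr0.
by rewrite [in RHS]scalar_mx_block opp_block_mx oppr0.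
Qed.

Lemma Jmx_tr n : (Jmx n)^T = - Jmx n :> 'M[R[i]]_(n + n).
Proof.
by rewrite /Jmx tr_block_mx !trmx0 linearN /= trmx1 opp_block_mx !oppr0 opprK.
Qed.

Definition cofactor_mx (w : form6) : 'M[R[i]]_(3 + 3) :=
  \matrix_(k, l) pf_cofactor (degree_part 2 (bits6 w)) k l.

Lemma mul_cofactor_mx (w : form6) : homogeneous 2 w ->
  mx2 w *m (cofactor_mx w)^T =
    (3%:R^-1 * (wedge w (wedge w w)) [set: 'I_(3 + 3)]%SET)%:M.
Proof.
move=> hw; have three : (3%:R : R[i]) != 0 by rewrite pnatr_eq0.
apply/matrixP => k m; apply: (mulfI three); rewrite mxE.
transitivity (3%:R * (\sum_(l < 6) bits_mx (degree_part 2 (bits6 w)) k l *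
    pf_cofactor (degree_part 2 (bits6 w)) m l)).
  by congr (_ * _); apply: eq_bigr => l _; rewrite mx2_bits_mx // !mxE.
rewrite (pf_cofactor_mul (bits6 w) k m) -bits6_top // mxE.
have [_|_] := eqVneq k m; last by rewrite mul0r mulr0.
by rewrite mul1r mulr1n mulrA mulfV // mul1r.
Qed.

(** The metric is w J^T, so the complex structures cancel in the definition of
    the inner product and leave 1/2 tr (w^-1 F); the inverse of w is given by the
    Pfaffian cofactors, which also compute F /\ w /\ w. *)
Lemma inner2_wedge (F w : form6) : homogeneous 2 F -> homogeneous 2 w ->
  (wedge (wedge w w) w) [set: 'I_(3 + 3)]%SET != 0 ->
  inner2 w F w = 3%:R / (wedge (wedge w w) w) [set: 'I_(3 + 3)]%SET *
                 (wedge F (wedge w w)) [set: 'I_(3 + 3)]%SET.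
Proof.
move=> hF hw; rewrite bits6_cube // => c0; have mulQ := mul_cofactor_mx hw.
have three : (3%:R : R[i]) != 0 by rewrite pnatr_eq0.
have two : (2%:R : R[i]) != 0 by rewrite pnatr_eq0.
set c := _ [set: _]%SET in c0 mulQ *; set X := _ [set: _]%SET.
have trQF : \tr ((cofactor_mx w)^T *m mx2 F) = 2%:R * X.
  rewrite /X bits6_top // -pf_cofactor_expand exchange_big /=; apply: eq_bigr => l _.
  by rewrite mxE; apply: eq_bigr => k _; rewrite mx2_bits_mx // !mxE.
(* The inverse of the matrix of w. *)
pose V := (3%:R / c) *: (cofactor_mx w)^T.
have WV : mx2 w *m V = 1%:M.
  rewrite /V -scalemxAr mulQ scale_scalar_mx; congr (_%:M).
  by rewrite mulrACA divff // mulVf // mulr1.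
have VW : V *m mx2 w = 1%:M by exact: mulmx1C.
have invmxE (A B : 'M[R[i]]_(3 + 3)) : A *m B = 1%:M -> invmx A = B.
  by move=> AB; have [Au _] := mulmx1_unit AB; rewrite -[LHS]mulmx1 -AB mulKmx.
have GE : invmx (kahler_metric w) = Jmx 3 *m V.
  apply: invmxE; rewrite /kahler_metric mulmxA -(mulmxA (mx2 w)) Jmx_tr mulNmx.
  by rewrite Jmx_sqr opprK mulmx1.
rewrite /inner2 GE mx2_skew mulmxN linearN /= -(mulmxA (_ *m mx2 F)) -(mulmxA (Jmx 3) V (mx2 w)) VW mulmx1.
rewrite mxtrace_mulC mulmxA mulmxA Jmx_sqr mulNmx mul1mx mulNmx linearN opprK.
rewrite /V -scalemxAl linearZ /= trQF mulrCA; congr (_ * _).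
by rewrite mulrA mulVf // mul1r.
Qed.

Lemma wedge_sqr_inner2 (F w : form6) : homogeneous 2 F -> homogeneous 2 w ->
  (wedge (wedge w w) w) [set: 'I_(3 + 3)]%SET != 0 ->
  wedge F (wedge w w) = 0 <-> inner2 w F w = 0.
Proof.
move=> hF hw w0; rewrite inner2_wedge //; split=> [->|/eqP].
  by rewrite [X in _ * X]ffunE mulr0.
rewrite mulf_eq0 mulf_eq0 invr_eq0 pnatr_eq0 (negPf w0) /= => /eqP X0.
have h6 := homogeneous_wedge hF (homogeneous_wedge hw hw).
apply/ffunP => S; rewrite [RHS]ffunE.
have [->//|ST] := eqVneq S [set: 'I_(3 + 3)]%SET.
apply: h6; apply: contra ST => /eqP c6; rewrite finset.eqEcard finset.subsetT.
by rewrite finset.cardsT card_ord c6.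
Qed.

(** The normalization makes the cube of w a nonzero multiple of Om /\ conj Om,
    and Om has no zeros. *)
Lemma kahler_cube (w Om : form6) (f : R[i]) : f != 0 -> Om = f *: vol ->
  6%:R^-1 *: wedge (wedge w w) w = ('i / 8%:R) *: wedge Om (conj_form Om) ->
  (wedge (wedge w w) w) [set: 'I_(3 + 3)]%SET != 0.
Proof.
move=> f0 -> /ffunP/(_ [set: 'I_(3 + 3)]%SET) e; apply/negP => /eqP w0.
move: e; rewrite !form_scaleE w0 mulr0 => /esym/eqP.
have -> : conj_form (f *: vol) = conjc f *: conj_form vol :> form6.
  by apply/ffunP => S; rewrite conj_formE !form_scaleE conj_formE; exact: rmorphM.
rewrite wedgeZl linearZ /= !form_scaleE !mulf_eq0 invr_eq0 pnatr_eq0.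
rewrite (negPf f0) fmorph_eq0 (negPf f0) (negPf wedge_vol_conj) !orbF /=.
by rewrite -sqrf_eq0 sqr_i oppr_eq0 oner_eq0.
Qed.

End Pfaffian.

(** * Directional derivatives under affine maps and their symmetry *)

Section CalculusLemmas.
Local Open Scope ring_scope.
Local Open Scope complex_scope.
Local Open Scope classical_set_scope.
Context {R : realType}.

(** phi has linear part L, as far as difference quotients can tell. *)
Definition affine_with (U V : lmodType R) (phi L : U -> V) :=
  forall (h : R) v x, phi (h *: v + x) = h *: L v + phi x.

Section Affine.
Variables (U V : normedModType R) (phi L : U -> V).
Hypothesis aff : affine_with phi L.

(** The difference quotients themselves agree, hence so do their limits and the
    existence of the limits. *)
Lemma growth_rate_affine (f : V -> R) x v :
  (fun h : R => h^-1 *: ((f \o phi \o shift x) (h *: v) - (f \o phi) x)) =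
  (fun h : R => h^-1 *: ((f \o shift (phi x)) (h *: L v) - f (phi x))).
Proof. by apply/funext => h /=; rewrite aff. Qed.

Lemma derive_affine (f : V -> R) x v : 'D_v (f \o phi) x = 'D_(L v) f (phi x).
Proof. by rewrite /derive growth_rate_affine. Qed.

Lemma derivable_affine (f : V -> R) x v :
  derivable f (phi x) (L v) -> derivable (f \o phi) x v.
Proof. by rewrite /derivable growth_rate_affine. Qed.

End Affine.

Lemma MVT_dir (V : normedModType R) (g : V -> R) (x v : V) (h : R) : 0 < h ->
  (forall t, 0 <= t <= h -> derivable g (t *: v + x) v) ->
  exists2 c, 0 <= c <= h & g (h *: v + x) - g x = 'D_v g (c *: v + x) * h.
Proof.
move=> h0 dg; pose phi (t : R) : V := t *: v + x.
have aff : affine_with (phi : R -> V) (fun t => t *: v).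
  by move=> s t u; rewrite /phi scalerDl scalerA addrA.
have dphi t : 0 <= t <= h -> derivable (g \o phi) t 1.
  move=> th; by apply: (@derivable_affine _ V phi _ aff g t 1); rewrite scale1r; exact: dg.
have dE t : 'D_1 (g \o phi) t = 'D_v g (phi t).
  by rewrite (@derive_affine _ V phi _ aff) scale1r.
have d1 t : t \in `]0, h[%R -> is_derive t (1 : R) (g \o phi) ('D_v g (phi t)).
  rewrite in_itv /= => /andP[t0 th]; rewrite -dE; apply: derivableP.
  by apply: dphi; rewrite !ltW.
have d2 : {in `[0, h]%R, forall t, derivable (g \o phi) t 1}.
  by move=> t; rewrite in_itv /=; exact: dphi.
have [c] := MVT h0 d1 (derivable_within_continuous d2).
rewrite in_itv /= => /andP[c0 ch] e.
by exists c; rewrite ?(ltW c0) ?(ltW ch)//; move: e; rewrite /= /phi scale0r add0r subr0.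
Qed.

(** The mean value theorem for the difference of f along v, followed by the one
    for its derivative along u. *)
Lemma second_difference (V : normedModType R) (f : V -> R) (x u v : V) (h : R) : 0 < h ->
  (forall s t, 0 <= s <= h -> 0 <= t <= h ->
     derivable f (s *: u + (t *: v + x)) u /\
     derivable ('D_u f) (t *: v + (s *: u + x)) v) ->
  exists s t, [/\ 0 <= s <= h, 0 <= t <= h &
    f (h *: u + (h *: v + x)) - f (h *: u + x) - f (h *: v + x) + f x
    = 'D_v ('D_u f) (t *: v + (s *: u + x)) * h * h].
Proof.
move=> h0 df.
have hh : 0 <= h <= h by apply/andP; split=> //; exact: ltW.
have zh : (0 : R) <= 0 <= h by apply/andP; split=> //; exact: ltW.
pose g y := f (y + h *: v) - f y.
have aff : affine_with (fun y => y + h *: v) id by move=> s y z; rewrite addrA.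
have d1 s : 0 <= s <= h -> derivable (f \o (fun y => y + h *: v)) (s *: u + x) u.
  move=> sh; apply: (derivable_affine aff).
  by rewrite -addrA [x + _]addrC; exact: (df s h sh hh).1.
have d2 s : 0 <= s <= h -> derivable f (s *: u + x) u.
  by move=> sh; have := (df s 0 sh zh).1; rewrite scale0r add0r.
have [s sh e] := @MVT_dir V g x u h h0 (fun s sh => derivableB (d1 s sh) (d2 s sh)).
have [t th e2] := @MVT_dir V ('D_u f) (s *: u + x) v h h0 (fun t th => (df s t sh th).2).
exists s, t; split=> //.
rewrite -e2; transitivity (g (h *: u + x) - g x).
  by rewrite /g -[h *: u + x + _]addrA ![x + h *: v]addrC; ring.
rewrite e; congr (_ * _).
rewrite (deriveB (d1 s sh) (d2 s sh)) (derive_affine aff) /=.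
by rewrite [s *: u + x + _]addrC.
Qed.

(** Makes the parallelograms of the second difference fit into the domain. *)
Lemma nbhs_plane (V : normedModType R) (x u v : V) (P : set V) : nbhs x P ->
  exists2 d, 0 < d & forall s t, `|s| < d -> `|t| < d -> P (s *: u + (t *: v + x)).
Proof.
move=> /nbhs_normP[e /= e0 Pe].
(* The displacement has norm at most d (|u| + |v|) < e. *)
pose d := e / (1 + `|u| + `|v|).
have D0 : 0 < 1 + `|u| + `|v| by rewrite -addrA ltr_wpDr// addr_ge0.
exists d; first by rewrite divr_gt0.
move=> s t sd td; apply: Pe => /=.
rewrite addrA [_ + x]addrC opprD addrA subrr sub0r normrN.
apply: le_lt_trans (ler_normD _ _) _; rewrite !normrZ.
have dE : d * (1 + `|u| + `|v|) = e by rewrite /d divfK// gt_eqF.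
have d0 : 0 < d by rewrite divr_gt0.
have h1 : `|s| * `|u| <= d * `|u| by apply: ler_wpM2r => //; exact: ltW.
have h2 : `|t| * `|v| <= d * `|v| by apply: ler_wpM2r => //; exact: ltW.
nra.
Qed.

Lemma mul_sqr_inj (h y z : R) : h != 0 -> y * h * h = z * h * h -> y = z.
Proof. by move=> h0 /(mulIf h0) /(mulIf h0). Qed.

Lemma close_to_common (a b m e : R) : `|a - m| < e / 2 -> `|b - m| < e / 2 -> `|a - b| <= e.
Proof.
rewrite [`|b - m|]distrC => am mb; apply: le_trans (ler_distD m a b) _.
by apply: ltW; rewrite (splitr e); exact: ltrD.
Qed.

(** The second difference of f over a small parallelogram is symmetric in its
    sides; divided by the squared length it is a value of either mixed derivative
    near x. *)
Lemma schwarz (V : normedModType R) (D : set V) (f : V -> R) (x u v : V) :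
  nbhs x D ->
  (forall y, D y -> derivable f y u /\ derivable f y v) ->
  (forall y, D y -> derivable ('D_u f) y v /\ derivable ('D_v f) y u) ->
  {for x, continuous ('D_v ('D_u f))} -> {for x, continuous ('D_u ('D_v f))} ->
  'D_v ('D_u f) x = 'D_u ('D_v f) x.
Proof.
move=> nD df ddf c1 c2; set a := LHS; set b := RHS.
apply/eqP; rewrite -subr_eq0 -normr_le0; apply/ler_addgt0Pr => e e0; rewrite add0r.
have e2 : 0 < e / 2 by rewrite divr_gt0.
have N1 : nbhs x [set y | `|a - 'D_v ('D_u f) y| < e / 2].
  by have /cvgr_dist_lt := c1; apply.
have N2 : nbhs x [set y | `|b - 'D_u ('D_v f) y| < e / 2].
  by have /cvgr_dist_lt := c2; apply.
have [d d0 Pd] := nbhs_plane u v (filterI nD (filterI N1 N2)).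
pose h := d / 2.
have h0 : 0 < h by rewrite divr_gt0.
have hd s : 0 <= s <= h -> `|s| < d.
  by case/andP => s0 sh; rewrite ger0_norm // (le_lt_trans sh)// /h; lra.
have sw (s t : R) : s *: u + (t *: v + x) = t *: v + (s *: u + x) by rewrite addrCA.
have [s t sh th|s [t [sh th E1]]] := @second_difference V f x u v h h0.
  have [Dy _] := Pd s t (hd _ sh) (hd _ th); split; first exact: (df _ Dy).1.
  by rewrite -sw; exact: (ddf _ Dy).1.
have [t' s' th' sh'|t' [s' [th' sh' E2]]] := @second_difference V f x v u h h0.
  have [Dy _] := Pd s' t' (hd _ sh') (hd _ th'); split; first by rewrite -sw; exact: (df _ Dy).2.
  exact: (ddf _ Dy).2.
have E : 'D_v ('D_u f) (t *: v + (s *: u + x)) = 'D_u ('D_v f) (s' *: u + (t' *: v + x)).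
  apply: mul_sqr_inj (lt0r_neq0 h0) _; refine (etrans (esym E1) (etrans _ E2)).
  by rewrite sw; congr (_ + _); exact: addrAC.
have [_ [/= A _]] := Pd s t (hd _ sh) (hd _ th).
have [_ [/= _ B]] := Pd s' t' (hd _ sh') (hd _ th').
rewrite sw E in A; exact: close_to_common A B.
Qed.

Lemma Ck_subset n k (D D' : set 'rV[R]_n) f : D' `<=` D -> Ck k D f -> Ck k D' f.
Proof.
move=> sub; elim: k f => [|k IH] f /= [c d]; first by split=> // x /sub; exact: c.
split=> [x /sub|j]; first exact: c.
by have [d1 d2] := d j; split=> [x /sub|]; [exact: d1|exact: IH].
Qed.

Lemma Ck_cst n k (D : set 'rV[R]_n) (c : R) : Ck k D (fun=> c).
Proof.
have cc (a : R) : forall x : 'rV[R]_n, D x -> {for x, continuous (fun=> a)}.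
  by move=> x _; exact: cst_continuous.
elim: k c => [|k IH] c /=; first by split=> //; exact: cc.
split=> [|j]; first exact: cc.
split=> [x _|]; first exact: derivable_cst.
have -> : (fun x : 'rV[R]_n => 'D_'e_j (fun=> c) x) = (fun=> 0).
  by apply/funext => x; exact: derive_cst.
exact: IH.
Qed.

Lemma Ck_eq n k (D : set 'rV[R]_n) f g : open D -> {in D, f =1 g} -> Ck k D f -> Ck k D g.
Proof.
move=> oD; have nfg (f' g' : 'rV[R]_n -> R) x : {in D, f' =1 g'} -> D x -> {near x, f' =1 g'}.
  move=> fg Dx; have : nbhs x D by exact: open_nbhs_nbhs.
  by apply: filterS => y Dy; apply: fg; rewrite inE.
have cfg (f' g' : 'rV[R]_n -> R) x : {in D, f' =1 g'} -> D x ->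
    {for x, continuous f'} -> {for x, continuous g'}.
  move=> fg Dx cf; rewrite /prop_for /continuous_at -fg ?inE//.
  by apply: cvg_trans _ cf; exact: (near_eq_cvg (nfg _ _ _ fg Dx)).
elim: k f g => [|k IH] f g fg /= [c d]; first by split=> // x Dx; exact: cfg (c x Dx).
split=> [x Dx|j]; first exact: cfg (c x Dx).
have [d1 d2] := d j; split=> [x Dx|].
  by apply: near_eq_derivable (d1 x Dx); exact: nfg.
by apply: IH d2 => x /[1!inE] Dx; apply: near_eq_derive; exact: nfg.
Qed.

(** Covers the projection of W x S^1 to W and the inclusion of a slice, with None for
    a coordinate direction that is collapsed. *)
Definition coordinate_map m n (phi : 'rV[R]_m -> 'rV[R]_n) (s : 'I_m -> option 'I_n) :=
  exists2 L : 'rV[R]_m -> 'rV[R]_n, affine_with phi L &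
    forall j, L 'e_j = if s j is Some k then 'e_k else 0.

Section CoordinateMaps.
Variables (m n : nat) (phi : 'rV[R]_m -> 'rV[R]_n) (s : 'I_m -> option 'I_n).
Hypotheses (aff : coordinate_map phi s) (cphi : continuous phi).

Lemma derive_coordinate_map f x j : 'D_'e_j (f \o phi) x =
  if s j is Some k then 'D_'e_k f (phi x) else 0 :> R.
Proof.
have [L aL Le] := aff; rewrite (derive_affine aL) Le.
by case: (s j) => //; rewrite derive0.
Qed.

Lemma Ck_coordinate_map k D f : Ck k D f -> Ck k (phi @^-1` D) (f \o phi).
Proof.
have cc g x : {for phi x, continuous g} -> {for x, continuous (g \o phi : _ -> R)}.
  by move=> cg; apply: continuous_comp; [exact: cphi|exact: cg].
elim: k f => [|k IH] f /= [c d]; first by split=> // x Dx; apply: cc; exact: c.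
split=> [x Dx|j]; first by apply: cc; exact: c.
have -> : (fun x => 'D_'e_j (f \o phi) x) =
   if s j is Some l then (fun x => 'D_'e_l f x) \o phi else fun=> 0.
  by apply/funext => x; rewrite derive_coordinate_map; case: (s j).
have [L aL Le] := aff; split.
  move=> x Dx; apply: (derivable_affine aL); rewrite Le; case: (s j) => [l|].
    exact: (d l).1.
  exact: derivable0.
case: (s j) => [l|]; last exact: Ck_cst.
exact: IH (d l).2.
Qed.

Lemma smooth_coordinate_map D f : smooth D f -> smooth (phi @^-1` D) (f \o phi).
Proof.
move=> sf k; have [h1 h2] := sf k.
by split; [exact: (Ck_coordinate_map h1)|exact: (Ck_coordinate_map h2)].
Qed.

Lemma partial_coordinate_map f x j : partial j (f \o phi) x =
  if s j is Some k then partial k f (phi x) else 0.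
Proof.
rewrite /partial.
have -> := derive_coordinate_map (fun y => complex.Re (f y)) x j.
have -> := derive_coordinate_map (fun y => complex.Im (f y)) x j.
by case: (s j).
Qed.

End CoordinateMaps.

Lemma smooth_subset n (D D' : set 'rV[R]_n) f : D' `<=` D -> smooth D f -> smooth D' f.
Proof. by move=> DD sf k; have [? ?] := sf k; split; apply: (Ck_subset DD). Qed.

Lemma smooth_eq n (D : set 'rV[R]_n) (f g : 'rV[R]_n -> R[i]) : open D -> {in D, f =1 g} -> smooth D f -> smooth D g.
Proof.
move=> oD fg sf k; have [? ?] := sf k.
by split; [apply: (Ck_eq oD (f := fun x => complex.Re (f x)))|
  apply: (Ck_eq oD (f := fun x => complex.Im (f x)))] => // x xD; rewrite fg.
Qed.

Lemma smooth0 n (D : set 'rV[R]_n) : smooth D (fun=> 0).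
Proof. by move=> k; split; exact: Ck_cst. Qed.

Lemma partial_near n (j : 'I_n) (f g : 'rV[R]_n -> R[i]) x : {near x, f =1 g} -> partial j f x = partial j g x.
Proof.
move=> fg; rewrite /partial; congr (_ +i* _);
  by apply: near_eq_derive; apply: filterS fg => y ->.
Qed.

Lemma partial_comm n (D : set 'rV[R]_n) f x i j : open D -> D x -> smooth D f ->
  partial i (partial j f) x = partial j (partial i f) x.
Proof.
move=> oD Dx sf; have nD : nbhs x D by exact: open_nbhs_nbhs.
have [[_ h1] [_ h2]] := sf 2.
have H (g : 'rV[R]_n -> R) : (forall j, (forall x, D x -> derivable g x 'e_j) /\ Ck 1 D ('D_'e_j g)) ->
   'D_'e_i ('D_'e_j g) x = 'D_'e_j ('D_'e_i g) x.
  move=> hg; have [gi [ci dgi]] := hg i; have [gj [cj dgj]] := hg j.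
  apply: (schwarz nD).
  - by move=> y Dy; split; [exact: gj|exact: gi].
  - by move=> y Dy; split; [exact: (dgj i).1|exact: (dgi j).1].
  - exact: (dgj i).2.1.
  - exact: (dgi j).2.1.
have e1 := H _ h1; have e2 := H _ h2.
exact (f_equal2 (@Complex R) e1 e2).
Qed.

End CalculusLemmas.

(** * Angle charts of the circle *)

Section CircleCharts.
Local Open Scope ring_scope.
Local Open Scope classical_set_scope.
Context {R : realType}.

(** Equal points would give t - a the cosine 1, but the sine of half that angle
    is positive. *)
Lemma expit_neq (a t : R) : a < t < a + 2 * pi -> expit t <> expit a.
Proof.
move=> /andP[at_ ta] /(congr1 val) [ec es].
pose x := (t - a) / 2.
have sx : 0 < sin x.
  by apply: sin_gt0_pi; rewrite /x; apply/andP; split; lra.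
have : cos (x *+ 2) = 1.
  have -> : x *+ 2 = t - a by rewrite /x mulr2n; lra.
  by rewrite cosB ec es -!expr2 cos2Dsin2.
rewrite cos_mulr2n -[cos x ^+ 2](addrK (sin x ^+ 2)) cos2Dsin2.
have : 0 < sin x ^+ 2 by rewrite exprn_gt0.
by rewrite mulr2n; lra.
Qed.

(** A rotation by - a reduces the claim to the cut at angle 0, where arccos
    computes the angle in the upper half circle and its reflection in the lower
    one. *)
Lemma angle_exists (a : R) (u : set_type (@circle_set R)) : u <> expit a ->
  exists t, a < t < a + 2 * pi /\ expit t = u.
Proof.
move=> ua.
have uE : (val u).1 ^+ 2 + (val u).2 ^+ 2 = 1 by have /set_mem := valP u.
set x := (val u).1 in uE; set y := (val u).2 in uE.
(* The coordinates of u rotated by - a. *)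
pose p := x * cos a + y * sin a; pose q := y * cos a - x * sin a.
have cs := cos2Dsin2 a.
have pq : p ^+ 2 + q ^+ 2 = 1.
  transitivity ((x ^+ 2 + y ^+ 2) * (cos a ^+ 2 + sin a ^+ 2)); last by rewrite uE cs mulr1.
  by rewrite /p /q; ring.
have back (t : R) : cos t = p -> sin t = q -> expit (a + t) = u.
  move=> cp sq; apply: val_inj; rewrite /= cosD sinD cp sq [RHS]surjective_pairing.
  rewrite -/x -/y; congr (_, _).
    transitivity (x * (cos a ^+ 2 + sin a ^+ 2)); last by rewrite cs mulr1.
    by rewrite /p /q; ring.
  transitivity (y * (cos a ^+ 2 + sin a ^+ 2)); last by rewrite cs mulr1.
  by rewrite /p /q; ring.
have q2 : 0 <= q ^+ 2 by exact: sqr_ge0.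
have p1 : -1 <= p <= 1 by move: pq q2; rewrite !expr2 => pq q2; apply/andP; split; nra.
have sE : sin (acos p) = `|q|.
  rewrite sin_acos // -sqrtr_sqr; congr Num.sqrt; lra.
have cE : cos (acos p) = p by apply: acosK; rewrite in_itv.
have pi0 := pi_gt0 R.
have a0 := acos_ge0 p1; have api := acos_lepi p1.
have [q0|q0] := leP 0 q.
  exists (a + acos p); rewrite back ?sE ?ger0_norm //; split=> //.
  have apos : acos p != 0.
    apply/eqP => e; apply: ua; rewrite -[LHS](back 0) ?addr0 ?cos0 ?sin0 //.
      by rewrite -cE e cos0.
    by rewrite -(ger0_norm q0) -sE e sin0.
  have {}apos : 0 < acos p by rewrite lt_def apos.
  apply/andP; split; lra.
have p_lt1 : p < 1.
  have [_ p1'] := andP p1; rewrite lt_neqAle p1' andbT; apply/eqP => e.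
  have : q ^+ 2 = 0 by move: pq; rewrite e expr1n; lra.
  by move/eqP; rewrite sqrf_eq0 lt_eqF.
have apos : 0 < acos p by apply: acos_gt0; have [-> _] := andP p1.
exists (a + (2 * pi - acos p)); split; first by apply/andP; split; lra.
have e2 : 2 * pi - acos p = - acos p + pi *+ 2 by rewrite -mulr_natl; lra.
apply: back; rewrite e2.
  by rewrite cosD2pi cosN.
by rewrite sinD2pi sinN sE ltr0_norm // opprK.
Qed.

Lemma circle_chartP (a : R) (u : pt (circle R)) : @dom _ _ (circle R) a u ->
  exists t, [/\ a < t < a + 2 * pi, expit t = u & @chart _ _ (circle R) a u = const_mx t].
Proof.
move=> /angle_exists[t ht]; rewrite /chart /=.
exists (xget 0 [set t | a < t < a + 2 * pi /\ expit t = u]).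
by case: (@xgetI _ 0 [set t | a < t < a + 2 * pi /\ expit t = u] t ht).
Qed.

End CircleCharts.

(** * Derivatives of complex and matrix valued functions *)

Section ComplexPartials.
Local Open Scope ring_scope.
Local Open Scope complex_scope.
Context {R : realType}.
Variables (n : nat) (j : 'I_n).
Implicit Types (f g : 'rV[R]_n -> R[i]) (x : 'rV[R]_n).

Definition has_partial f x :=
  derivable (fun y => complex.Re (f y)) x 'e_j /\ derivable (fun y => complex.Im (f y)) x 'e_j.

Lemma smooth_has_partial (D : set 'rV[R]_n) f x : smooth D f -> D x -> has_partial f x.
Proof. by move=> sf Dx; have [[_ h1] [_ h2]] := sf 1; split; [exact: (h1 j).1|exact: (h2 j).1]. Qed.

Lemma has_partial_parts f u v x : (fun y => complex.Re (f y)) = u -> (fun y => complex.Im (f y)) = v ->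
  derivable u x 'e_j -> derivable v x 'e_j -> has_partial f x.
Proof. by move=> eu ev du dv; subst u v; split. Qed.

(** Replaces the real and imaginary parts by other expressions for them. *)
Lemma partial_parts f u v x : (fun y => complex.Re (f y)) = u -> (fun y => complex.Im (f y)) = v ->
  partial j f x = ('D_'e_j u x) +i* ('D_'e_j v x).
Proof. by move=> eu ev; subst u v. Qed.

Lemma has_partialD f g x : has_partial f x -> has_partial g x ->
  has_partial (fun y => f y + g y) x /\
  partial j (fun y => f y + g y) x = partial j f x + partial j g x.
Proof.
move=> [rf mf] [rg mg].
have er : (fun y => complex.Re (f y + g y)) = (fun y => complex.Re (f y)) + (fun y => complex.Re (g y)).
  by apply/funext => y; rewrite raddfD.
have ei : (fun y => complex.Im (f y + g y)) = (fun y => complex.Im (f y)) + (fun y => complex.Im (g y)).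
  by apply/funext => y; rewrite raddfD.
split; first exact: (has_partial_parts er ei (derivableD rf rg) (derivableD mf mg)).
by rewrite (partial_parts _ er ei) (deriveD rf rg) (deriveD mf mg).
Qed.

Lemma leibniz_parts (y z : R[i]) (dry diy drz diz : R) :
  ((complex.Re y * drz + complex.Re z * dry) - (complex.Im y * diz + complex.Im z * diy)) +i*
  ((complex.Re y * diz + complex.Im z * dry) + (complex.Im y * drz + complex.Re z * diy)) =
  (dry +i* diy) * z + y * (drz +i* diz).
Proof.
case: y z => [a b] [c d]; apply/eqP; rewrite eq_complex /=; apply/andP; split; apply/eqP; ring.
Qed.

Lemma has_partialM f g x : has_partial f x -> has_partial g x ->
  has_partial (fun y => f y * g y) x /\
  partial j (fun y => f y * g y) x = partial j f x * g x + f x * partial j g x.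
Proof.
move=> [rf mf] [rg mg].
have er : (fun y => complex.Re (f y * g y)) = (fun y => complex.Re (f y)) * (fun y => complex.Re (g y))
    - (fun y => complex.Im (f y)) * (fun y => complex.Im (g y)).
  by apply/funext => y; rewrite !fctE; case: (f y) (g y) => [? ?] [? ?].
have ei : (fun y => complex.Im (f y * g y)) = (fun y => complex.Re (f y)) * (fun y => complex.Im (g y))
    + (fun y => complex.Im (f y)) * (fun y => complex.Re (g y)).
  by apply/funext => y; rewrite !fctE; case: (f y) (g y) => [? ?] [? ?].
have d1 := derivableM rf rg; have d2 := derivableM mf mg.
have d3 := derivableM rf mg; have d4 := derivableM mf rg.
split; first exact: (has_partial_parts er ei (derivableB d1 d2) (derivableD d3 d4)).
rewrite (partial_parts _ er ei) (deriveB d1 d2) (deriveD d3 d4).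
rewrite (deriveM rf rg) (deriveM mf mg) (deriveM rf mg) (deriveM mf rg).
exact: leibniz_parts.
Qed.

Lemma has_partial_conj f x : has_partial f x ->
  has_partial (fun y => conjc (f y)) x /\
  partial j (fun y => conjc (f y)) x = conjc (partial j f x).
Proof.
move=> [rf mf].
have er : (fun y => complex.Re (conjc (f y))) = (fun y => complex.Re (f y)).
  by apply/funext => y; case: (f y).
have ei : (fun y => complex.Im (conjc (f y))) = - (fun y => complex.Im (f y)).
  by apply/funext => y; rewrite !fctE; case: (f y).
split; first exact: (has_partial_parts er ei rf (derivableN mf)).
by rewrite (partial_parts _ er ei) (deriveN mf).
Qed.

Lemma partial_cst (c : R[i]) x : has_partial (fun=> c) x /\ partial j (fun=> c) x = 0.
Proof.
split; first by split; exact: derivable_cst.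
by rewrite /partial !derive_cst.
Qed.

Lemma has_partial_sum I (r : seq I) (F : I -> 'rV[R]_n -> R[i]) x :
  (forall i, has_partial (F i) x) ->
  has_partial (fun y => \sum_(i <- r) F i y) x /\
  partial j (fun y => \sum_(i <- r) F i y) x = \sum_(i <- r) partial j (F i) x.
Proof.
move=> hF; elim: r => [|i r [h IH]].
  have [h e] := partial_cst 0 x; rewrite big_nil -e.
  by rewrite (_ : (fun y => _) = (fun=> 0)) //; apply/funext => y; rewrite big_nil.
have [h' e] := has_partialD (hF i) h.
rewrite big_cons -IH -e.
by rewrite (_ : (fun y => \sum_(k <- i :: r) _) = (fun y => F i y + \sum_(k <- r) F k y)) //;
   apply/funext => y; rewrite big_cons.
Qed.

Variable r : nat.
Implicit Types A B : 'rV[R]_n -> 'M[R[i]]_r.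

Definition mpartial A x : 'M[R[i]]_r := \matrix_(k, l) partial j (fun y => A y k l) x.
Definition has_mpartial A x := forall k l, has_partial (fun y => A y k l) x.

Lemma has_mpartialD A B x : has_mpartial A x -> has_mpartial B x ->
  has_mpartial (fun y => A y + B y) x /\
  mpartial (fun y => A y + B y) x = mpartial A x + mpartial B x.
Proof.
move=> hA hB.
have E k l : (fun y => (A y + B y) k l) = (fun y => A y k l + B y k l).
  by apply/funext => y; rewrite mxE.
split; first by move=> k l; rewrite E; exact: (has_partialD (hA k l) (hB k l)).1.
by apply/matrixP => k l; rewrite !mxE E (has_partialD (hA k l) (hB k l)).2.
Qed.

Lemma has_mpartialM A B x : has_mpartial A x -> has_mpartial B x ->
  has_mpartial (fun y => A y *m B y) x /\
  mpartial (fun y => A y *m B y) x = mpartial A x *m B x + A x *m mpartial B x.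
Proof.
move=> hA hB.
have E k l : (fun y => (A y *m B y) k l) = (fun y => \sum_m A y k m * B y m l).
  by apply/funext => y; rewrite mxE.
have H k l m := has_partialM (hA k m) (hB m l).
have S k l := has_partial_sum (index_enum 'I_r) (fun m => (H k l m).1).
split; first by move=> k l; rewrite E; exact: (S k l).1.
apply/matrixP => k l; rewrite mxE E (S k l).2 mxE mxE [X in _ + X]mxE -big_split /=.
by apply: eq_bigr => m _; rewrite (H k l m).2 !mxE.
Qed.

Definition adjoint (M : 'M[R[i]]_r) : 'M[R[i]]_r := (map_mx conjc M)^T.

Lemma has_mpartial_adjoint A x : has_mpartial A x ->
  has_mpartial (fun y => adjoint (A y)) x /\
  mpartial (fun y => adjoint (A y)) x = adjoint (mpartial A x).
Proof.
move=> hA.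
have E k l : (fun y => adjoint (A y) k l) = (fun y => conjc (A y l k)).
  by apply/funext => y; rewrite !mxE.
split; first by move=> k l; rewrite E; exact: (has_partial_conj (hA l k)).1.
by apply/matrixP => k l; rewrite mxE E (has_partial_conj (hA l k)).2 !mxE.
Qed.

Lemma adjointD M N : adjoint (M + N) = adjoint M + adjoint N.
Proof. by apply/matrixP => k l; rewrite !mxE; exact: rmorphD. Qed.

Lemma adjointM M N : adjoint (M *m N) = adjoint N *m adjoint M.
Proof. by rewrite /adjoint map_mxM trmx_mul. Qed.

Lemma adjointZ c M : adjoint (c *: M) = conjc c *: adjoint M.
Proof. by apply/matrixP => k l; rewrite !mxE; exact: rmorphM. Qed.

End ComplexPartials.

(** * The curvature of a Chern connection in a chart *)

Section DbarAlgebra.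
Local Open Scope ring_scope.
Variables (K : numFieldType) (J : K).

Lemma dbar_dbar_cancel (a b c d : K) : J * J = -1 ->
  a - b - (J * c - J * d) + J * (J * a - d + (c - J * b)) = 0.
Proof. by move=> JJ; ring: JJ. Qed.

Lemma conj_sums_eq0_re (u v : K) : u - J * v = 0 -> u + J * v = 0 -> u = 0.
Proof.
move=> e1 e2; have : u + u = 0 by rewrite -[RHS](addr0 0) -{1}e1 -e2; ring.
by move/eqP; rewrite -mulr2n mulrn_eq0 => /eqP.
Qed.

Lemma conj_sums_eq0_im (u v : K) : J * J = -1 -> u - J * v = 0 -> u + J * v = 0 -> v = 0.
Proof.
move=> JJ e1 e2; have u0 := conj_sums_eq0_re e1 e2; move/eqP: e2; rewrite u0 add0r mulf_eq0.
by case/orP => /eqP // J0; move/eqP: JJ; rewrite J0 mul0r eq_sym oppr_eq0 oner_eq0.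
Qed.

Lemma addr_shuffle (V : zmodType) (u1 u2 u3 v1 v2 v3 : V) :
  u1 + (u2 + u3) + (v1 + v2 + v3) = u1 + u2 + (v3 + v2) + (u3 + v1).
Proof.
by rewrite [u1 + (u2 + u3)]addrA -(addrA v1) [v2 + v3]addrC [LHS]addrA -(addrA (u1 + u2)) [RHS]addrAC.
Qed.
End DbarAlgebra.

Section LocalCurvature.
Local Open Scope ring_scope.
Local Open Scope complex_scope.
Local Open Scope classical_set_scope.
Context {R : realType}.
Local Notation form := Defs.form.
Variable r : nat.
Local Notation adj := (@adjoint R r).

Lemma mpartial_near n (j : 'I_n) (A B : 'rV[R]_n -> 'M[R[i]]_r) x : {near x, A =1 B} ->
  mpartial j A x = mpartial j B x.
Proof.
move=> AB; apply/matrixP => k l; rewrite !mxE; apply: partial_near.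
by apply: filterS AB => y ->.
Qed.

Section Curvature.
Variables (n : nat) (D : set 'rV[R]_n).
Variables (h : 'rV[R]_n -> 'M[R[i]]_r) (al : 'I_n -> 'rV[R]_n -> 'M[R[i]]_r).
Hypothesis oD : open D.
Hypothesis sh : forall k l, smooth D (fun y => h y k l).
Hypothesis sal : forall j k l, smooth D (fun y => al j y k l).

(** The terms of F_ij that are not antisymmetrized yet. *)
Definition half_curv (i j : 'I_n) x := mpartial i (al j) x + al i x *m al j x.
Definition curv_mx (i j : 'I_n) x := half_curv i j x - half_curv j i x.

(** Differentiate dH = A^* H + H A and antisymmetrize: the second derivatives of
    H and the mixed terms A_j^* H A_i + A_i^* H A_j are symmetric and drop out. *)
Lemma unitary_curv : (forall x, D x -> forall j, mpartial j h x = adj (al j x) *m h x + h x *m al j x) ->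
  forall x, D x -> forall i j, adj (curv_mx i j x) *m h x + h x *m curv_mx i j x = 0.
Proof.
move=> uni x Dx i j.
have nD : nbhs x D by exact: open_nbhs_nbhs.
have hh i' : has_mpartial i' h x by move=> k l; exact: smooth_has_partial (sh k l) Dx.
have ha i' j' : has_mpartial i' (al j') x by move=> k l; exact: smooth_has_partial (sal j' k l) Dx.
have E i' j' : mpartial i' (mpartial j' h) x =
    adj (half_curv i' j' x) *m h x + h x *m half_curv i' j' x
    + (adj (al j' x) *m h x *m al i' x + adj (al i' x) *m h x *m al j' x).
  rewrite (@mpartial_near _ _ _ (fun y => adj (al j' y) *m h y + h y *m al j' y)); last first.
    by apply: filterS nD => y Dy; exact: uni.
  have [p1 e1] := has_mpartial_adjoint (ha i' j').
  have [p2 e2] := has_mpartialM p1 (hh i').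
  have [p3 e3] := has_mpartialM (hh i') (ha i' j').
  rewrite (has_mpartialD p2 p3).2 e2 e3 e1 uni // /half_curv adjointD adjointM.
  rewrite !mulmxDl !mulmxDr !mulmxA.
  exact: addr_shuffle.
have S : mpartial i (mpartial j h) x = mpartial j (mpartial i h) x.
  have e (j' : 'I_n) k l : (fun y => mpartial j' h y k l) = partial j' (fun y => h y k l).
    by apply/funext => y; rewrite mxE.
  have e2 i' j' k l : mpartial i' (mpartial j' h) x k l = partial i' (partial j' (fun y => h y k l)) x.
    by refine (etrans (mxE _ _ _ _) _); exact (f_equal (fun g => partial i' g x) (e j' k l)).
  apply/matrixP => k l.
  exact (etrans (e2 i j k l) (etrans (partial_comm i j oD Dx (sh k l)) (esym (e2 j i k l)))).
have {}S := etrans (esym (E i j)) (etrans S (E j i)).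
rewrite [X in _ = _ + X]addrC in S; have {}S := addIr _ S.
rewrite /curv_mx -scaleN1r adjointD adjointZ.
have -> : conjc (-1) = -1 :> R[i] by rewrite rmorphN1.
rewrite !scaleN1r mulmxDl mulmxDr mulNmx mulmxN addrACA S.
by rewrite -opprD subrr.
Qed.

End Curvature.

Lemma curv_mx_anti n (al : 'I_n -> 'rV[R]_n -> 'M[R[i]]_r) i j x :
  curv_mx al j i x = - curv_mx al i j x.
Proof. by rewrite /curv_mx opprB. Qed.

(** The connection matrix vanishes on d/dzbar_p and d/dzbar_q, and every term of the
    curvature on this pair contains one of these two values or a derivative of it. *)
Lemma type10_curv n (D : set 'rV[R]_(n + n)) (al : 'I_(n + n) -> 'rV[R]_(n + n) -> 'M[R[i]]_r) :
  open D -> (forall j k l, smooth D (fun y => al j y k l)) ->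
  (forall x, D x -> forall p, al (rshift n p) x = 'i *: al (lshift n p) x) ->
  forall x, D x -> forall p q,
    curv_mx al (lshift n p) (lshift n q) x - curv_mx al (rshift n p) (rshift n q) x
    + 'i *: (curv_mx al (lshift n p) (rshift n q) x + curv_mx al (rshift n p) (lshift n q) x) = 0.
Proof.
move=> oD sal t10 x Dx p q.
have nD : nbhs x D by exact: open_nbhs_nbhs.
have ha i' j' : has_mpartial i' (al j') x by move=> k l; exact: smooth_has_partial (sal j' k l) Dx.
have X i' q' : half_curv al i' (rshift n q') x = 'i *: half_curv al i' (lshift n q') x.
  rewrite /half_curv t10 // -scalemxAr scalerDr; congr (_ + _).
  rewrite (@mpartial_near _ _ _ (fun y => 'i *: al (lshift n q') y)); last first.
    by apply: filterS nD => y Dy; exact: t10.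
  apply/matrixP => k l; rewrite !mxE.
  have -> : (fun y => ('i *: al (lshift n q') y) k l) = (fun y => 'i * al (lshift n q') y k l).
    by apply/funext => y; rewrite mxE.
  have [p0 e0] := partial_cst i' 'i x.
  by rewrite (has_partialM p0 (ha i' (lshift n q') k l)).2 e0 mul0r add0r.
rewrite /curv_mx !X.
set a := half_curv _ _ _ _; set b := half_curv _ _ _ _; set c := half_curv _ _ _ _.
set d := half_curv _ _ _ _.
move: a b c d => a b c d.
apply/matrixP => k l; rewrite !mxE; apply: dbar_dbar_cancel; exact: sqr_im.
Qed.

(** Unitarity says that the curvature is fixed by this conjugate-linear map when
    P is the inverse of the Gram matrix Q. *)
Definition gram_adj (P Q M : 'M[R[i]]_r) := - (P *m adj M *m Q).

Section GramAdj.
Variables P Q : 'M[R[i]]_r.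
Local Notation T := (gram_adj P Q).

Lemma gram_adjD M N : T (M + N) = T M + T N.
Proof. by rewrite /gram_adj adjointD mulmxDr mulmxDl opprD. Qed.

Lemma gram_adjZ c M : T (c *: M) = conjc c *: T M.
Proof. by rewrite /gram_adj adjointZ -scalemxAr -scalemxAl scalerN. Qed.

Lemma gram_adjN M : T (- M) = - T M.
Proof.
rewrite -scaleN1r gram_adjZ (_ : conjc (-1) = -1) ?scaleN1r //.
by rewrite rmorphN1.
Qed.

Lemma gram_adj0 : T 0 = 0.
Proof. by have := gram_adjZ 0 0; rewrite conjc0 !scale0r. Qed.
End GramAdj.

(** By unitarity [gram_adj] fixes the curvature, and it exchanges the
    (0,2)-component with the (2,0)-component because it conjugates scalars.  The
    first vanishes by [type10_curv], hence so does the second. *)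
Lemma chern_curv n (D : set 'rV[R]_(n + n)) (h : 'rV[R]_(n + n) -> 'M[R[i]]_r)
    (al : 'I_(n + n) -> 'rV[R]_(n + n) -> 'M[R[i]]_r) :
  open D -> (forall k l, smooth D (fun y => h y k l)) ->
  (forall j k l, smooth D (fun y => al j y k l)) ->
  (forall x, D x -> h x \in unitmx) ->
  (forall x, D x -> forall j, mpartial j h x = adj (al j x) *m h x + h x *m al j x) ->
  (forall x, D x -> forall p, al (rshift n p) x = 'i *: al (lshift n p) x) ->
  forall x, D x -> forall p q,
    curv_mx al (lshift n p) (lshift n q) x = curv_mx al (rshift n p) (rshift n q) x /\
    curv_mx al (lshift n p) (rshift n q) x = curv_mx al (lshift n q) (rshift n p) x.
Proof.
move=> oD sh sal hu uni t10 x Dx p q.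
have e := type10_curv oD sal t10 Dx p q.
have adjF i j : curv_mx al i j x = - (invmx (h x) *m adj (curv_mx al i j x) *m h x).
  have := unitary_curv oD sh sal uni Dx i j; move/eqP; rewrite addr_eq0 => /eqP e'.
  by rewrite -mulmxA -mulmxN e' opprK mulKmx // hu.
set a := curv_mx al (lshift n p) (lshift n q) x in e *.
set b := curv_mx al (rshift n p) (rshift n q) x in e *.
set c := curv_mx al (lshift n p) (rshift n q) x in e *.
rewrite (curv_mx_anti al (lshift n q)) in e; set d := curv_mx al (lshift n q) _ x in e *.
have Ta : gram_adj (invmx (h x)) (h x) a = a by exact/esym/adjF.
have Tb : gram_adj (invmx (h x)) (h x) b = b by exact/esym/adjF.
have Tc : gram_adj (invmx (h x)) (h x) c = c by exact/esym/adjF.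
have Td : gram_adj (invmx (h x)) (h x) d = d by exact/esym/adjF.
move: a b c d e Ta Tb Tc Td => a b c d e Ta Tb Tc Td.
have e' : a - b - 'i *: (c - d) = 0.
  have := congr1 (gram_adj (invmx (h x)) (h x)) e.
  rewrite gram_adjD gram_adjD gram_adjN gram_adjZ gram_adjD gram_adjN gram_adj0 conjc_im.
  by rewrite Ta Tb Tc Td scaleNr.
split; apply/eqP; rewrite -subr_eq0; apply/eqP; apply/matrixP => k l.
  move/matrixP: e => /(_ k l); move/matrixP: e' => /(_ k l); rewrite !mxE.
  exact: conj_sums_eq0_re.
move/matrixP: e => /(_ k l); move/matrixP: e' => /(_ k l); rewrite !mxE.
exact: (conj_sums_eq0_im sqr_im).
Qed.

End LocalCurvature.

(** * Curvature on a manifold *)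

Section ChartLevel.
Local Open Scope ring_scope.
Local Open Scope complex_scope.
Local Open Scope classical_set_scope.
Context {R : realType}.
Local Notation form := Defs.form.

Lemma complex_manifold_chartK n (X : atlas R (n + n)) : complex_manifold X ->
  forall (i : idx X) p, dom i p -> chart_inv i (chart i p) = p.
Proof. by move=> [_ _ _ h _] i; have [_ _] := h i. Qed.

(** The inverse chart is continuous on the open image of the chart. *)
Lemma complex_manifold_open n (X : atlas R (n + n)) (i : idx X) (O : set (pt X)) :
  complex_manifold X -> open O -> open (chart i @` (dom i `&` O)).
Proof.
move=> [_ _ _ h _] oO; have [od oc cK _ ci] := h i.
rewrite openE => _ [p [dp Op] <-].
have N1 : nbhs (chart i p) (chart i @` dom i) by apply: open_nbhs_nbhs; split=> //; exists p.
have N2 : nbhs (chart i p) ([set y | O (chart_inv i y)]).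
  have c := ci (chart i p) (ex_intro2 _ _ p dp erefl).
  by apply: c; rewrite cK //; exact: open_nbhs_nbhs.
apply: filterS (filterI N1 N2) => _ [[q dq <-] /=]; rewrite cK // => Oq.
by exists q.
Qed.

Section Atlas.
Variables (n : nat) (X : atlas R n).

Lemma d_funE (f : pt X -> R[i]) i p j :
  d_fun f i p [set j]%SET = partial j (f \o chart_inv i) (chart i p).
Proof. exact: sum_dx1. Qed.

Lemma homogeneous_d_fun (f : pt X -> R[i]) i p : homogeneous 1 (d_fun f i p).
Proof. exact: homogeneous_sum_dx. Qed.

(** The coefficients outside degree k are zero on the whole chart, so their
    derivatives vanish. *)
Lemma homogeneous_partial k (a : form_field X) i (p : pt X) j : (forall q, homogeneous k (a i q)) ->
  homogeneous k [ffun S => partial j (fun x => a i (chart_inv i x) S) (chart i p)].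
Proof.
move=> ha S hS; rewrite ffunE (_ : (fun x => _) = (fun=> 0)); last first.
  by apply/funext => x; exact: ha.
by have [_ ->] := partial_cst j 0 (chart i p).
Qed.

Lemma homogeneous_d_form k (a : form_field X) i (p : pt X) : (forall q, homogeneous k (a i q)) ->
  homogeneous k.+1 (d_form a i p).
Proof.
move=> ha; apply: homogeneous_sum => j _; apply: (@homogeneous_wedge _ _ 1 k).
  exact: homogeneous_dx.
exact: homogeneous_partial.
Qed.

Lemma mx2_d_form (a : form_field X) i (p : pt X) s t : (forall q, homogeneous 1 (a i q)) ->
  mx2 (d_form a i p) s t = partial s (fun x => a i (chart_inv i x) [set t]%SET) (chart i p)
                         - partial t (fun x => a i (chart_inv i x) [set s]%SET) (chart i p).
Proof.
move=> ha; rewrite /d_form linear_sum summxE.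
pose d j u := partial j (fun x => a i (chart_inv i x) [set u]%SET) (chart i p).
transitivity (\sum_j ((j == s)%:R * d j t - (j == t)%:R * d j s)).
  apply: eq_bigr => j _; rewrite /= mx2_wedge; last exact: homogeneous_partial.
    by rewrite mxE !dx1 [X in _ * X - _]ffunE [X in _ - _ * X]ffunE.
  exact: homogeneous_dx.
rewrite sumrB (bigD1 s) //= (bigD1 t (P := predT)) //= !eqxx !mul1r !big1 ?addr0 //.
- by move=> j /negPf ->; rewrite mul0r.
- by move=> j /negPf ->; rewrite mul0r.
Qed.

Variables (r : nat) (E : bundle X r).

Definition coef_mx (A : local_forms E) a i (j : 'I_n) (x : 'rV[R]_n) : 'M[R[i]]_r :=
  \matrix_(k, l) A a i (chart_inv i x) k l [set j]%SET.

Lemma homogeneous_connection (A : local_forms E) a i p k l : connection A ->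
  homogeneous 1 (A a i p k l).
Proof. by move=> [hA _]; have [_ h _ _] := hA a k l. Qed.

Lemma homogeneous_curvature (A : local_forms E) a i p k l : connection A ->
  homogeneous 2 (curvature A a i p k l).
Proof.
move=> hA; rewrite mxE; apply: homogeneousD.
  by apply: homogeneous_d_form => q; exact: homogeneous_connection.
apply: homogeneous_sum => m _.
by apply: (@homogeneous_wedge _ _ 1 1); exact: homogeneous_connection.
Qed.

Lemma mx2_curvature (A : local_forms E) a i p k l s t : connection A ->
  chart_inv i (chart i p) = p ->
  mx2 (curvature A a i p k l) s t = curv_mx (coef_mx A a i) s t (chart i p) k l.
Proof.
move=> hA cK; rewrite [curvature A a i p k l]mxE raddfD /= mxE mx2_d_form; last first.
  by move=> q; exact: homogeneous_connection.
have cE j y k' l' : coef_mx A a i j y k' l' = A a i (chart_inv i y) k' l' [set j]%SET by exact: mxE.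
have mE s' t' : mpartial s' (coef_mx A a i t') (chart i p) k l =
    partial s' (fun x => A a i (chart_inv i x) k l [set t']%SET) (chart i p).
  by rewrite [LHS]mxE; congr (partial s' _ _); apply/funext => y; exact: cE.
have hE s' t' : half_curv (coef_mx A a i) s' t' (chart i p) k l =
   partial s' (fun x => A a i (chart_inv i x) k l [set t']%SET) (chart i p)
   + \sum_m A a i p k m [set s']%SET * A a i p m l [set t']%SET.
  rewrite [LHS]mxE mE mxE; congr (_ + _); apply: eq_bigr => m _.
  by rewrite !cE cK.
have wE : mx2 (\sum_m wedge (A a i p k m) (A a i p m l)) s t =
   \sum_m A a i p k m [set s]%SET * A a i p m l [set t]%SET
   - \sum_m A a i p k m [set t]%SET * A a i p m l [set s]%SET.
  rewrite linear_sum summxE -sumrB; apply: eq_bigr => m _.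
  rewrite /= mx2_wedge; [|exact: homogeneous_connection..].
  by rewrite mxE.
rewrite wE /curv_mx.
rewrite (mxE _ _ k l).
have -> : (- half_curv (coef_mx A a i) t s (chart i p)) k l = - half_curv (coef_mx A a i) t s (chart i p) k l.
  by rewrite mxE.
by rewrite !hE opprD addrACA.
Qed.

End Atlas.

(** A kernel vector would have length zero. *)
Lemma posdef_unitmx r (M : 'M[R[i]]_r) :
  (forall v : 'cV[R[i]]_r, v != 0 -> 0 < ((map_mx conjc v)^T *m M *m v) 0 0) -> M \in unitmx.
Proof.
move=> pos; rewrite -unitmx_tr unitmxE unitfE; apply/negP => /det0P[v v0 vM].
have := pos v^T; rewrite -(inj_eq (@trmx_inj _ _ _)) trmxK trmx0 => /(_ v0).
have -> : M *m v^T = 0 -> forall u : 'rV[R[i]]_r, u *m M *m v^T = 0.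
  by move=> e u; rewrite -mulmxA e mulmx0.
- by rewrite mxE ltxx.
by apply: (can_inj (@trmxK _ _ _)); rewrite trmx_mul trmxK trmx0.
Qed.

Lemma chern_curvature11 (W : atlas R (3 + 3)) r (E : bundle W r) H (A : local_forms E) :
  complex_manifold W -> (forall a, open (@tdom _ _ _ _ E a)) ->
  hermitian_metric H -> chern_connection H A -> curvature11 A.
Proof.
move=> hW oE [sH _ posH] [cA uA tA] a i p [ap ip] k l.
have cK := complex_manifold_chartK hW.
pose D := chart i @` (dom i `&` tdom a).
have oD : open D by exact: complex_manifold_open.
pose h y : 'M[R[i]]_r := H a (chart_inv i y).
apply/(type11P (homogeneous_curvature _ _ _ _ _ cA)) => s t.
rewrite !(mx2_curvature _ _ _ _ _ cA (cK _ _ ip)).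
have Dp : D (chart i p) by exists p.
have sh k' l' : smooth D (fun y => h y k' l') by exact: sH.
have sal j k' l' : smooth D (fun y => coef_mx A a i j y k' l').
  have [_ _ sA _] := cA.1 a k' l'.
  rewrite (_ : (fun y => _) = (fun y => A a i (chart_inv i y) k' l' [set j]%SET)); first exact: sA.
  by apply/funext => y; rewrite mxE.
have hu y : D y -> h y \in unitmx.
  by move=> [q [iq aq] <-]; rewrite /h cK //; apply: posdef_unitmx; exact: posH.
have uni y : D y -> forall j,
    mpartial j h y = adjoint (coef_mx A a i j y) *m h y + h y *m coef_mx A a i j y.
  move=> [q [iq aq] <-] j; apply/matrixP => k' l'.
  have := congr1 (fun f : form R (3 + 3) => f [set j]%SET) (uA a i q (conj aq iq) k' l').
  rewrite d_funE form_sumE => e; refine (etrans (mxE _ _ _ _) (etrans e _)).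
  rewrite /h.
  rewrite mxE [X in X + _]mxE [X in _ + X]mxE -big_split /=; apply: eq_bigr => m _.
  rewrite form_addE !form_scaleE conj_formE !mxE cK //.
  by congr (_ + _); exact: mulrC.
have t10 y : D y -> forall m, coef_mx A a i (rshift 3 m) y = 'i *: coef_mx A a i (lshift 3 m) y.
  move=> [q [iq aq] <-] m; apply/matrixP => k' l'; rewrite !mxE cK //.
  have [c ->] := tA a i q (conj aq iq) k' l'.
  rewrite !form_sumE mulr_sumr; apply: eq_bigr => m' _.
  by rewrite !form_scaleE dzl dzr mulrCA.
by have [-> ->] := chern_curv oD sh sal hu uni t10 Dp s t.
Qed.

End ChartLevel.

(** * Charts of the product with the circle *)

Section ProductWithCircle.
Local Open Scope ring_scope.
Local Open Scope complex_scope.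
Local Open Scope classical_set_scope.
Context {R : realType}.
Local Notation form := Defs.form.

Section CoordinateSplit.
Variable n : nat.

Lemma lsubmx_coordinate_map : coordinate_map (@lsubmx R 1 n 1)
  (fun j => match fintype.split j with inl k => Some k | inr _ => None end).
Proof.
exists (@lsubmx R 1 n 1) => [h v x|j]; first by rewrite linearP.
elim/ord_addP: j => [l|].
  rewrite (unsplitK (inl l)); apply/rowP => k; rewrite !mxE !eqxx /=.
  by rewrite (inj_eq (@lshift_inj _ _)).
rewrite (unsplitK (inr 0)); apply/rowP => k; rewrite !mxE !eqxx /=.
by rewrite eq_lrshift.
Qed.

Lemma row_mx_coordinate_map (c : 'rV[R]_1) :
  coordinate_map (fun x : 'rV[R]_n => row_mx x c) (fun j => Some (lshift 1 j)).
Proof.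
exists (fun x => row_mx x 0) => [h v x|j].
  by rewrite scale_row_mx add_row_mx scaler0 add0r.
apply/rowP; elim/ord_addP => [k|]; rewrite ?row_mxEl ?row_mxEr !mxE !eqxx /=.
  by rewrite (inj_eq (@lshift_inj _ _)).
by rewrite eq_rlshift.
Qed.

Lemma continuous_row_mx (c : 'rV[R]_1) : continuous (fun x : 'rV[R]_n => row_mx x c).
Proof.
move=> x A /nbhs_ballP[e /= e0 eA].
apply/nbhs_ballP; exists e => //= y [_ xy]; apply: eA; split=> // i.
elim/ord_addP => [j|]; first by rewrite !row_mxEl; exact: xy.
by rewrite !row_mxEr; exact: ballxx.
Qed.

End CoordinateSplit.

Lemma ext_set1r_cyl n (b : form R n) : cyl b [set rshift n 0]%SET = 0.
Proof. by rewrite ext_set1r cyl1E. Qed.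

Variable W : atlas R (3 + 3).
Hypothesis hW : complex_manifold W.
Local Notation M := (WxS1 W).

(** The image of the product chart over O, the circle being an interval of angles. *)
Definition cylinder_chart (i : idx W) (s : R) (O : set (pt W)) : set 'rV[R]_(3 + 3 + 1) :=
  [set x | (chart i @` (dom i `&` O)) (lsubmx x) /\ s < rsubmx x 0 0 < s + 2 * pi].

(** The preimage under the two coordinate projections of an open set and of an
    open interval. *)
Lemma open_cylinder_chart i s O : open O -> open (cylinder_chart i s O).
Proof.
move=> oO; apply: openI.
  apply: open_comp; first by move=> x _; exact: continuous_lsubmx.
  exact: complex_manifold_open.
suff -> : (fun x : 'rV[R]_(3 + 3 + 1) => is_true (s < rsubmx x 0 0 < s + 2 * pi)) =
    (fun x : 'rV[R]_(3 + 3 + 1) => rsubmx x 0 0) @^-1` [set` `]s, s + 2 * pi[%R].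
  apply: open_comp; last exact: interval_open.
  move=> x _; apply: (@continuous_comp _ _ _ (@rsubmx R 1 (3 + 3) 1) (fun y => y 0 0)).
    exact: continuous_rsubmx.
  exact: coord_continuous.
by apply/seteqP; split=> x /=; rewrite in_itv.
Qed.

Lemma sub_cylinder_chart i s O :
  @chart _ _ M (i, s) @` (@dom _ _ M (i, s) `&` [set q | O q.1]) `<=` cylinder_chart i s O.
Proof.
move=> _ [[p u] [[/= ip su] Op] <-]; rewrite /cylinder_chart /=.
rewrite row_mxKl row_mxKr; split; first by exists p.
by have [t [st _ /= ->]] := circle_chartP su; rewrite mxE.
Qed.

Lemma chart_in_cylinder i s p u : @dom _ _ M (i, s) (p, u) ->
  cylinder_chart i s setT (@chart _ _ M (i, s) (p, u)).
Proof. by move=> d; apply: sub_cylinder_chart; exists (p, u). Qed.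

Lemma cylinder_chart_inv i s O x : cylinder_chart i s O x ->
  @dom _ _ M (i, s) (@chart_inv _ _ M (i, s) x) /\ O (chart_inv i (lsubmx x)).
Proof.
move=> [[p [ip Op] e] st]; rewrite /= -e (complex_manifold_chartK hW ip); split=> //.
by split=> //; exact: expit_neq.
Qed.

Lemma p1_formT (a : form_field W) ia q : @dom _ _ M ia q -> p1_form a ia q = cyl (a ia.1 q.1).
Proof. by move=> d; rewrite /p1_form asboolT. Qed.

Lemma p1_formF (a : form_field W) ia q : ~ @dom _ _ M ia q -> p1_form a ia q = 0.
Proof. by move=> d; rewrite /p1_form asboolF. Qed.

Lemma p1_form_chart (a : form_field W) i s x : cylinder_chart i s setT x ->
  p1_form a (i, s) (@chart_inv _ _ M (i, s) x) = cyl (a i (chart_inv i (lsubmx x))).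
Proof. by move=> /cylinder_chart_inv[d _]; rewrite p1_formT. Qed.

Lemma jac_ll i j s t p u k l : jac (X := M) (i, s) (j, t) (p, u) (lshift 1 k) (lshift 1 l) = jac i j p k l.
Proof.
rewrite !mxE.
pose f (x : 'rV[R]_(3 + 3)) : R := chart j (chart_inv i x) 0 k.
transitivity ('D_'e_(lshift 1 l) (f \o @lsubmx R 1 (3 + 3) 1) (row_mx (chart i p) (@chart _ _ (circle R) s u))).
  by congr ('D_'e_(lshift 1 l) _ _); apply/funext => x; rewrite /= row_mxEl.
rewrite (derive_coordinate_map (@lsubmx_coordinate_map _)).
by rewrite (unsplitK (inl l)) row_mxKl.
Qed.

Lemma jac_lr i j s t p u k : jac (X := M) (i, s) (j, t) (p, u) (lshift 1 k) (rshift (3 + 3) 0) = 0.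
Proof.
rewrite mxE.
pose f (x : 'rV[R]_(3 + 3)) : R := chart j (chart_inv i x) 0 k.
transitivity ('D_'e_(rshift (3 + 3) 0) (f \o @lsubmx R 1 (3 + 3) 1) (row_mx (chart i p) (@chart _ _ (circle R) s u))).
  by congr ('D_'e_(rshift (3 + 3) 0) _ _); apply/funext => x; rewrite /= row_mxEl.
rewrite (derive_coordinate_map (@lsubmx_coordinate_map _)).
by rewrite (unsplitK (inr 0)).
Qed.

(** The form on the left has no dtheta component, so only the rows of the
    Jacobian that belong to W matter; the coordinate changes of the circle never
    enter. *)
Lemma pull_jac_cyl i j s t p u (b : form R (3 + 3)) : homogeneous 1 b ->
  pull (jac (X := M) (i, s) (j, t) (p, u)) (cyl b) = cyl (pull (jac i j p) b).
Proof.
move=> hb; have hc := homogeneous_cyl hb.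
apply: one_formP; first exact: homogeneous_pull1.
  by apply: homogeneous_cyl; exact: homogeneous_pull1.
elim/ord_addP => [l|]; rewrite pull_one_formE // big_split_ord /= big_ord1.
  rewrite [X in _ + X * _]ext_set1r_cyl mul0r addr0.
  rewrite ext_set1l cyl0E pull_one_formE //; apply: eq_bigr => k _.
  by rewrite ext_set1l cyl0E jac_ll.
rewrite !ext_set1r_cyl mul0r addr0 big1 // => k _.
by rewrite jac_lr mulr0.
Qed.

End ProductWithCircle.

(** * Pull-back of connections to the product *)

Section PullBack.
Local Open Scope ring_scope.
Local Open Scope complex_scope.
Local Open Scope classical_set_scope.
Context {R : realType}.
Local Notation form := Defs.form.
Variable W : atlas R (3 + 3).
Hypothesis hW : complex_manifold W.
Local Notation M := (WxS1 W).

(** Near each chart point g is the composite of f with the projection to W. *)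
Lemma smooth_p1 i s (O : set (pt W)) (f : pt W -> R[i]) (g : pt M -> R[i]) : open O ->
  smooth (chart i @` (dom i `&` O)) (f \o chart_inv i) ->
  (forall x, cylinder_chart i s O x -> g (@chart_inv _ _ M (i, s) x) = f (chart_inv i (lsubmx x))) ->
  smooth (@chart _ _ M (i, s) @` (@dom _ _ M (i, s) `&` [set q | O q.1])) (g \o @chart_inv _ _ M (i, s)).
Proof.
move=> oO sf fg.
apply: (smooth_subset (D := cylinder_chart i s O)); first exact: sub_cylinder_chart.
apply: (smooth_eq (f := (f \o chart_inv i) \o @lsubmx R 1 (3 + 3) 1)).
- exact: open_cylinder_chart.
- by move=> x /[1!inE] /fg.
apply: (smooth_subset (D := @lsubmx R 1 (3 + 3) 1 @^-1` (chart i @` (dom i `&` O)))).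
  by move=> x [].
apply: (smooth_coordinate_map (@lsubmx_coordinate_map _ _)) => //.
by move=> x; exact: continuous_lsubmx.
Qed.

Lemma d_fun_p1 (f : pt W -> R[i]) ia (q : pt M) :
  d_fun (X := M) (fun q => f q.1) ia q = cyl (d_fun f ia.1 q.1).
Proof.
apply: one_formP; first exact: homogeneous_d_fun.
  by apply: homogeneous_cyl; exact: homogeneous_d_fun.
have E j := partial_coordinate_map (@lsubmx_coordinate_map R (3 + 3)) (f \o chart_inv ia.1)
              (@chart _ _ M ia q) j.
elim/ord_addP => [j|].
  rewrite ext_set1l cyl0E -ext_set1l !d_funE; refine (etrans (E _) _).
  by rewrite (unsplitK (inl j)) /= row_mxKl.
rewrite ext_set1r_cyl d_funE; refine (etrans (E _) _).
by rewrite (unsplitK (inr 0)).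
Qed.

Lemma cyl_chart_near i s p u : @dom _ _ M (i, s) (p, u) ->
  \forall x \near @chart _ _ M (i, s) (p, u), cylinder_chart i s setT x.
Proof.
move=> d; apply: open_nbhs_nbhs; split; last exact: chart_in_cylinder.
by apply: open_cylinder_chart => //; exact: openT.
Qed.

(** The components of the pull-back do not depend on the angle, so dtheta does
    not occur.  The formula for them holds on a neighbourhood of the chart point
    only, as the pull-back is set to 0 outside the chart domain. *)
Lemma d_form_p1 (a : form_field W) ia (q : pt M) : @dom _ _ M ia q ->
  d_form (p1_form a) ia q = cyl (d_form a ia.1 q.1).
Proof.
case: ia q => i s [p u] d.
have near_eq S : {near @chart _ _ M (i, s) (p, u),
    (fun x => p1_form a (i, s) (@chart_inv _ _ M (i, s) x) S) =1
    (fun x => cyl (a i (chart_inv i (lsubmx x))) S)}.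
  by apply: filterS (cyl_chart_near d) => x /(p1_form_chart hW) ->.
have cylS b S (x : 'rV[R]_(3 + 3 + 1)) : cyl (a i (chart_inv i (lsubmx x))) (ext b S) =
    (if b then 0 else a i (chart_inv i (lsubmx x)) S).
  by case: b; [exact: cyl1E|exact: cyl0E].
have P j S : partial j (fun x => p1_form a (i, s) (@chart_inv _ _ M (i, s) x) S) (@chart _ _ M (i, s) (p, u)) =
    cyl [ffun S' => if fintype.split j is inl k then partial k (fun x => a i (chart_inv i x) S') (chart i p) else 0] S.
  rewrite (partial_near _ (near_eq S)).
  have [b [T ->]] : exists b T, S = ext b T by do 2!eexists; exact: ext_surj.
  have -> : (fun x : 'rV[R]_(3 + 3 + 1) => cyl (a i (chart_inv i (lsubmx x))) (ext b T)) =
      (fun x : 'rV[R]_(3 + 3 + 1) => if b then 0 else a i (chart_inv i (lsubmx x)) T).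
    by apply/funext => x; exact: cylS.
  case: b; first by rewrite cyl1E; have [_ ->] := partial_cst j (0 : R[i]) (@chart _ _ M (i, s) (p, u)).
  rewrite cyl0E ffunE.
  have := partial_coordinate_map (@lsubmx_coordinate_map R (3 + 3)) (fun x => a i (chart_inv i x) T)
              (@chart _ _ M (i, s) (p, u)) j.
  rewrite [X in partial _ X]/comp => ->; case: (fintype.split j) => // k.
  by rewrite /= row_mxKl.
rewrite /d_form linear_sum big_split_ord /= big_ord1 [X in _ + X](_ : _ = 0) ?addr0; last first.
  rewrite (_ : [ffun S => _] = 0) ?linear0 //; apply/ffunP => S; rewrite ffunE P.
  rewrite (unsplitK (inr 0)) [X in cyl X _](_ : _ = 0) ?linear0 //.
apply: eq_bigr => j _; rewrite cyl_wedge cyl_dx; congr wedge.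
by apply/ffunP => S; rewrite ffunE P (unsplitK (inl j)).
Qed.

Variables (r : nat) (E : bundle W r).
Implicit Types A : local_forms E.

Lemma p1_connectionT A a ia (q : pt M) k l : @dom _ _ M ia q ->
  p1_connection A a ia q k l = cyl (A a ia.1 q.1 k l).
Proof. by move=> d; rewrite mxE p1_formT. Qed.

Lemma p1_connectionF A a ia (q : pt M) k l : ~ @dom _ _ M ia q ->
  p1_connection A a ia q k l = 0.
Proof. by move=> d; rewrite mxE p1_formF. Qed.

Lemma curvature_p1 A a ia (q : pt M) k l : @dom _ _ M ia q ->
  curvature (p1_connection A) a ia q k l = cyl (curvature A a ia.1 q.1 k l).
Proof.
move=> d; rewrite [LHS]mxE [curvature A _ _ _ _ _]mxE [RHS]linearD /=; congr (_ + _).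
  rewrite -(d_form_p1 _ d); congr (d_form _ ia q).
  by apply/funext => jb; apply/funext => q'; exact: mxE.
rewrite [RHS]linear_sum; apply: eq_bigr => m _.
by rewrite /= cyl_wedge !p1_connectionT.
Qed.

Lemma is_form_p1 (O : set (pt W)) (a : form_field W) : open O -> is_form 1 O a ->
  is_form 1 [set q : pt M | O q.1] (p1_form a).
Proof.
move=> oO [a0 ah as_ at_]; split.
- move=> ia q nd; have [d|d] := pselect (@dom _ _ M ia q); last by rewrite p1_formF.
  rewrite p1_formT // a0 ?linear0 // => -[iq Oq]; apply: nd; split=> //.
- move=> ia q; have [d|d] := pselect (@dom _ _ M ia q).
    by rewrite p1_formT //; exact: homogeneous_cyl.
  by rewrite p1_formF //; exact: homogeneous0.
- move=> [i s] S; have [b [T ->]] : exists b T, S = ext b T by do 2!eexists; exact: ext_surj.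
  apply: (@smooth_p1 i s O (fun p => if b then 0 else a i p T) (fun q => p1_form a (i, s) q (ext b T))) => //.
    case: b; first exact: smooth0.
    exact: as_.
  move=> x [[p [ip Op] e] sx]; rewrite p1_form_chart //; last by split=> //; exists p.
  by case: b; [exact: cyl1E|exact: cyl0E].
- move=> [i s] [j t] [p u] [[d1 d2] Op]; rewrite !p1_formT //.
  have d1' := d1.1; have d2' := d2.1.
  by rewrite pull_jac_cyl // -at_.
Qed.

Lemma connection_p1 A : (forall a, open (@tdom _ _ _ _ E a)) -> connection A ->
  connection (p1_connection A).
Proof.
move=> oE [fA gA]; split.
  move=> a k l; have := is_form_p1 (oE a) (fA a k l).
  rewrite (_ : p1_form _ = (fun ia q => p1_connection A a ia q k l)) //.
  by apply/funext => ia; apply/funext => q; rewrite mxE.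
move=> a b ia q [[aq bq] d] k l.
have d1 := d.1.
have g := gA a b ia.1 q.1 (conj (conj aq bq) d1) k l.
rewrite (d_fun_p1 (fun p => @trans _ _ _ _ E a b p k l)).
transitivity (cyl (\sum_m @trans _ _ _ _ E a b q.1 k m *: A b ia.1 q.1 m l)).
  rewrite linear_sum; apply: eq_bigr => m _.
  by rewrite p1_connectionT // linearZ.
rewrite g linearD linear_sum; congr (_ + _); apply: eq_bigr => m _.
by rewrite p1_connectionT // linearZ.
Qed.

Lemma hermitian_p1 (H : tidx E -> pt W -> 'M[R[i]]_r) : (forall a, open (@tdom _ _ _ _ E a)) ->
  hermitian_metric H -> hermitian_metric (E := p1_bundle E) (fun a q => H a q.1).
Proof.
move=> oE [sH gH pH]; split; last 2 first.
- by move=> a b q [aq bq]; exact: gH.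
- by move=> a q aq; exact: pH.
move=> a k l [i s]; apply: (@smooth_p1 i s (@tdom _ _ _ _ E a) (fun p => H a p k l) (fun q => H a q.1 k l)) => //.
exact: sH.
Qed.

Lemma unitary_p1 (H : tidx E -> pt W -> 'M[R[i]]_r) A : unitary H A ->
  unitary (E := p1_bundle E) (fun a q => H a q.1) (p1_connection A).
Proof.
move=> uA a ia q [aq d] k l; have d1 := d.1.
rewrite (d_fun_p1 (fun p => H a p k l)) (uA a ia.1 q.1 (conj aq d1) k l) linear_sum.
apply: eq_bigr => m _; rewrite !p1_connectionT // linearD conj_form_cyl.
by rewrite !linearZ.
Qed.

Section Instanton.
Variables (w Om : form_field W).
Hypothesis cy : calabi_yau w Om.

Lemma instanton_p1 A (a : tidx E) ia (q : pt M) k l : connection A -> @dom _ _ M ia q ->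
  wedge (curvature (p1_connection A) a ia q k l) (star_phi w Om ia q) = 0 <->
  inner2 (w ia.1 q.1) (curvature A a ia.1 q.1 k l) (w ia.1 q.1) = 0 /\
  type11 (curvature A a ia.1 q.1 k l).
Proof.
move=> cA d; have d1 := d.1.
have [_ [fw _ _ _ _] [_ [f [f0 _ fE]]] vol_eq] := cy.
have hw : homogeneous 2 (w ia.1 q.1) by have [_ h _ _] := fw.
have hF := homogeneous_curvature a ia.1 q.1 k l cA.
have OmE : Om ia.1 q.1 = f ia.1 q.1 *: vol by exact: fE.
have w3 := kahler_cube (f0 _ _ d1) OmE (vol_eq _ _ d1).
rewrite curvature_p1 // /star_phi !p1_formT // (cyl_wedge_star _ _ _).
by rewrite OmE (wedge_Re_vol hF (f0 _ _ d1)) (wedge_sqr_inner2 hF hw w3).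
Qed.

End Instanton.

End PullBack.

(** * Descent of invariant connections *)

Section Descent.
Local Open Scope ring_scope.
Local Open Scope complex_scope.
Local Open Scope classical_set_scope.
Context {R : realType}.
Local Notation form := Defs.form.
Variable W : atlas R (3 + 3).
Hypothesis hW : complex_manifold W.
Local Notation M := (WxS1 W).
Variables (r : nat) (E : bundle W r).
Hypothesis oE : forall a, open (@tdom _ _ _ _ E a).
Implicit Types (A : local_forms E) (B : local_forms (p1_bundle E)).

(** The slice through the point opposite to the cut of the chart with index 0. *)
Let u0 : pt (circle R) := expit (pi : R).

Lemma base_dom : @dom _ _ (circle R) 0 u0.
Proof. by apply: expit_neq; have := pi_gt0 R; lra. Qed.

Lemma base_domW i p : @dom _ _ M (i, 0) (p, u0) <-> dom i p.
Proof. by split=> [[]|ip] //; split=> //; exact: base_dom. Qed.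

Lemma base_chart : exists c : 'rV[R]_1, @chart _ _ (circle R) 0 u0 = c /\ expit (c 0 0) = u0.
Proof. by have [t [_ e ->]] := circle_chartP base_dom; exists (const_mx t); rewrite mxE. Qed.

(** Restriction to the slice W x {u0} recovers a connection from its pull-back. *)
Lemma p1_connection_inj A A' : connection A -> connection A' ->
  p1_connection A = p1_connection A' -> A = A'.
Proof.
move=> cA cA' e; apply/funext => a; apply/funext => i; apply/funext => p.
apply/matrixP => k l.
have [ip|nip] := pselect (dom i p).
  have d := (base_domW i p).2 ip.
  have := congr1 (fun B : local_forms (p1_bundle E) => slice false (B a (i, 0) (p, u0) k l)) e.
  by rewrite !p1_connectionT // !slice0_cyl.
have [z _ _ _] := cA.1 a k l; have [z' _ _ _] := cA'.1 a k l.
by rewrite z ?z' // => -[].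
Qed.

Definition slice_connection B : local_forms E :=
  fun a i p => \matrix_(k, l) slice false (B a (i, 0) (p, u0) k l).

Lemma slice_connectionE B a i p k l : slice_connection B a i p k l = slice false (B a (i, 0) (p, u0) k l).
Proof. exact: mxE. Qed.

Lemma slice_add n b (x y : form R (n + 1)) : slice b (x + y) = slice b x + slice b y.
Proof. exact: linearD. Qed.

Lemma slice_sumZ n b I (s : seq I) (c : I -> R[i]) (F : I -> form R (n + 1)) :
  slice b (\sum_(m <- s) c m *: F m) = \sum_(m <- s) c m *: slice b (F m).
Proof. by rewrite linear_sum; apply: eq_bigr => m _; rewrite /= linearZ. Qed.

Lemma slice1_one_form n (b : form R (n + 1)) : homogeneous 1 b ->
  b [set rshift n 0]%SET = 0 -> slice true b = 0.
Proof.
move=> hb b0; apply/ffunP => S; rewrite [LHS]ffunE [RHS]ffunE.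
have [->|S0] := eqVneq S finset.set0; first by rewrite -ext_set1r.
by apply: hb; rewrite card_ext addn1 eqSS cards_eq0.
Qed.

(** Invariance under rotations makes the components at any angle equal to those
    at u0, and the dtheta component vanishes. *)
Lemma p1_slice_connection B : connection B -> S1_invariant B -> p1_connection (slice_connection B) = B.
Proof.
move=> [fB _] [inv th]; apply/funext => a; apply/funext => -[i s]; apply/funext => -[p u].
apply/matrixP => k l.
have [d|nd] := pselect (@dom _ _ M (i, s) (p, u)); last first.
  rewrite p1_connectionF //; have [z _ _ _] := fB a k l.
  by rewrite z // => -[].
rewrite p1_connectionT //= slice_connectionE.
have d0 : @dom _ _ M (i, 0) (p, u0) by apply/base_domW; exact: d.1.
rewrite (inv a i s 0 p u u0 d d0) cyl_slice //.
apply: slice1_one_form; last exact: th.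
by have [_ h _ _] := fB a k l.
Qed.

Lemma smooth_slice i (O : set (pt W)) (g : pt M -> R[i]) :
  smooth (@chart _ _ M (i, 0) @` (@dom _ _ M (i, 0) `&` [set q | O q.1])) (g \o @chart_inv _ _ M (i, 0)) ->
  smooth (chart i @` (dom i `&` O)) (fun x => g (chart_inv i x, u0)).
Proof.
have [c [cE cu]] := base_chart => sg.
have := smooth_coordinate_map (@row_mx_coordinate_map R (3 + 3) c) (@continuous_row_mx R (3 + 3) c) sg.
rewrite (_ : _ \o _ = (fun x => g (chart_inv i x, u0))); last first.
  by apply/funext => x; rewrite /= row_mxKl row_mxKr cu.
apply: smooth_subset => _ [p [ip Op] <-].
by exists (p, u0); [split=> //; apply/base_domW|rewrite -cE].
Qed.

Lemma d_fun_slice (g : pt M -> R[i]) i p :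
  slice false (d_fun g (i, 0) (p, u0)) = d_fun (fun p => g (p, u0)) i p.
Proof.
have [c [cE cu]] := base_chart.
apply: one_formP; first by apply: homogeneous_slice0; exact: homogeneous_d_fun.
  exact: homogeneous_d_fun.
move=> j; rewrite ffunE -ext_set1l !d_funE.
have e := partial_coordinate_map (@row_mx_coordinate_map R (3 + 3) c)
  (g \o @chart_inv _ _ M (i, 0)) (chart i p) j.
have fE : (g \o @chart_inv _ _ M (i, 0)) \o (fun x => row_mx x c) =
    (fun p => g (p, u0)) \o chart_inv i.
  by apply/funext => x; rewrite /= row_mxKl row_mxKr cu.
exact (etrans (f_equal (fun y => partial (lshift 1 j) (g \o @chart_inv _ _ M (i, 0))
  (row_mx (chart i p) y)) cE) (etrans (esym e) (f_equal (fun h => partial j h (chart i p)) fE))).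
Qed.

Lemma connection_slice B : connection B -> S1_invariant B -> connection (slice_connection B).
Proof.
move=> cB iB; have BE := p1_slice_connection cB iB; have [fB gB] := cB.
split.
  move=> a k l; have [z h s t] := fB a k l; split.
  - move=> i p nd; rewrite slice_connectionE z ?linear0 // => -[/base_domW ip Op].
    exact: nd.
  - by move=> i p; rewrite slice_connectionE; exact: homogeneous_slice0.
  - move=> i S.
    rewrite (_ : (fun x => _) = (fun x => B a (i, 0) (chart_inv i x, u0) k l (ext false S))).
      exact: (@smooth_slice i (@tdom _ _ _ _ E a) (fun q => B a (i, 0) q k l (ext false S)) (s _ _)).
    by apply/funext => x; rewrite slice_connectionE ffunE.
  - move=> i j p [[ip jp] Op]; have hA := homogeneous_slice0 (h (j, 0) (p, u0)).
    rewrite slice_connectionE (t (i, 0) (j, 0) (p, u0)); last first.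
      by split=> //; split; apply/base_domW.
    have d : @dom _ _ M (j, 0) (p, u0) by apply/base_domW.
    have := congr1 (fun B : local_forms (p1_bundle E) => B a (j, 0) (p, u0) k l) BE.
    rewrite p1_connectionT //= => <-; rewrite pull_jac_cyl ?slice0_cyl // slice_connectionE //.
move=> a b i p [[ap bp] ip] k l.
have d : @dom _ _ M (i, 0) (p, u0) by apply/base_domW.
transitivity (slice false (\sum_m @trans _ _ _ _ E a b p k m *: B b (i, 0) (p, u0) m l)).
  by rewrite slice_sumZ; apply: eq_bigr => m _; rewrite slice_connectionE.
refine (etrans (congr1 (slice false) (gB a b (i, 0) (p, u0) (conj (conj ap bp) d) k l)) _).
refine (etrans (slice_add _ _ _) _); congr (_ + _); last exact: d_fun_slice.
by rewrite slice_sumZ; apply: eq_bigr => m _; rewrite slice_connectionE.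
Qed.

Lemma hermitian_slice (K : tidx E -> pt M -> 'M[R[i]]_r) :
  hermitian_metric (E := p1_bundle E) K -> hermitian_metric (E := E) (fun a p => K a (p, u0)).
Proof.
move=> [sK gK pK]; split.
- by move=> a k l i; exact: (@smooth_slice i (@tdom _ _ _ _ E a) (fun q => K a q k l) (sK a k l (i, 0))).
- by move=> a b p abp; exact: (gK a b (p, u0)).
- by move=> a p ap; exact: (pK a (p, u0)).
Qed.

Lemma slice_conj_form n b (a : form R (n + 1)) : slice b (conj_form a) = conj_form (slice b a).
Proof. by apply/ffunP => S; rewrite [LHS]ffunE !conj_formE ffunE. Qed.

Lemma unitary_slice (K : tidx E -> pt M -> 'M[R[i]]_r) B :
  unitary (E := p1_bundle E) K B -> unitary (E := E) (fun a p => K a (p, u0)) (slice_connection B).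
Proof.
move=> uB a i p [ap ip] k l.
have d : @dom _ _ M (i, 0) (p, u0) by apply/base_domW.
have := uB a (i, 0) (p, u0) (conj ap d) k l.
move/(congr1 (slice false)); rewrite d_fun_slice => ->.
rewrite linear_sum; apply: eq_bigr => m _.
by rewrite /= linearD !linearZ /= slice_conj_form !slice_connectionE.
Qed.

Lemma S1_invariant_p1 A : S1_invariant (p1_connection A).
Proof.
split=> [a i s t p u v d d'|a ia q k l].
  by apply/matrixP => k l; rewrite !p1_connectionT.
have [d|d] := pselect (@dom _ _ M ia q); last by rewrite p1_connectionF // ffunE.
by rewrite p1_connectionT //; exact: ext_set1r_cyl.
Qed.

Lemma pull_inclusion_cyl (b : form R (3 + 3)) : homogeneous 1 b ->
  pull (col_mx 1%:M 0) (cyl b) = b.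
Proof.
move=> hb; apply: one_formP => //.
  by apply: homogeneous_pull1; exact: homogeneous_cyl.
move=> l; rewrite pull_one_formE; last exact: homogeneous_cyl.
rewrite big_split_ord /= big_ord1 ext_set1r_cyl mul0r addr0.
have T (k : 'I_(3 + 3)) : cyl b [set lshift 1 k]%SET * (col_mx 1%:M 0 (lshift 1 k) l)%:C =
    b [set k]%SET * (k == l)%:R.
  by rewrite ext_set1l cyl0E col_mxEu mxE; case: (k == l).
rewrite (eq_bigr _ (fun k _ => T k)) (bigD1 l) //= eqxx mulr1 big1 ?addr0 // => k /negPf kl.
by rewrite kl mulr0.
Qed.

Lemma induces_dbar_p1 A : connection A ->
  induces_dbar (p1_connection A) <->
  (forall (a : tidx E) i p, (tdom a `&` dom i) p -> forall k l, type10 (A a i p k l)).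
Proof.
move=> cA; split=> [dB a i p [ap ip] k l|tA a ia q [d aq] k l].
  have d : @dom _ _ M (i, 0) (p, u0) by apply/base_domW.
  have := dB a (i, 0) (p, u0) (conj d ap) k l.
  rewrite p1_connectionT // pull_inclusion_cyl //; exact: homogeneous_connection.
rewrite p1_connectionT // pull_inclusion_cyl; last exact: homogeneous_connection.
by apply: tA; split=> //; exact: d.1.
Qed.

Section Correspondence.
Variables (w Om : form_field W).
Hypothesis cy : calabi_yau w Om.

Lemma G2_instanton_p1 A : connection A ->
  (exists2 H, hermitian_metric H & unitary H A) -> curvature11 A -> omega_trace_free w A ->
  G2_instanton w Om (p1_connection A).
Proof.
move=> cA [H hH uH] F11 Ftr; split.
- exact: connection_p1.
- by exists (fun a q => H a q.1); [exact: hermitian_p1|exact: unitary_p1].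
move=> a ia q [d aq] k l; apply/(instanton_p1 hW cy a k l cA d).
by split; [apply: Ftr|apply: F11]; split=> //; exact: d.1.
Qed.

(** The restriction to the slice pulls back to B, so the pointwise criterion
    [instanton_p1] applies to it. *)
Lemma G2_instanton_descends B : G2_instanton w Om B -> S1_invariant B ->
  exists A, [/\ connection A, exists2 H, hermitian_metric H & unitary H A,
    curvature11 A, omega_trace_free w A & p1_connection A = B].
Proof.
move=> [cB [K hK uK] iB] sB; have BE := p1_slice_connection cB sB.
have cA := connection_slice cB sB.
have HF a i p : (tdom a `&` dom i) p -> forall k l,
    inner2 (w i p) (curvature (slice_connection B) a i p k l) (w i p) = 0 /\
    type11 (curvature (slice_connection B) a i p k l).
  move=> [ap ip] k l.
  have d : @dom _ _ M (i, 0) (p, u0) by apply/base_domW.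
  have := iB a (i, 0) (p, u0) (conj d ap) k l.
  by rewrite -{1}BE => /(instanton_p1 hW cy a k l cA d).
exists (slice_connection B); split=> //.
- exists (fun a p => K a (p, u0)); [exact: hermitian_slice|exact: unitary_slice].
- by move=> a i p ip k l; exact: (HF a i p ip k l).2.
- by move=> a i p ip k l; exact: (HF a i p ip k l).1.
Qed.

End Correspondence.
End Descent.

Local Open Scope classical_set_scope.

Theorem proposition8 (R : realType) (W : atlas R (3 + 3)) (w Om : form_field W)
    (r : nat) (E : bundle W r)
    (hW : calabi_yau w Om) (hE : holomorphic_bundle E) :
  set_bij [set A : local_forms E | HYM w A]
          [set B : local_forms (p1_bundle E) |
             [/\ G2_instanton w Om B, S1_invariant B & induces_dbar B]]
          (@p1_connection R W r E)
  /\
  set_bij [set A : local_forms E | HYM_smooth w A]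
          [set B : local_forms (p1_bundle E) |
             G2_instanton w Om B /\ S1_invariant B]
          (@p1_connection R W r E).
Proof.
have cW : complex_manifold W by case: hW.
have oE : forall a, open (@tdom _ _ _ _ E a) by case: hE.
split; split.
- move=> A [[H hH [cA uA tA]] trA]; split.
  + apply: G2_instanton_p1 => //; first by exists H.
    exact: (chern_curvature11 cW oE hH).
  + exact: S1_invariant_p1.
  + exact/(induces_dbar_p1 cA).
- move=> A A' /set_mem[[H _ [cA _ _]] _] /set_mem[[H' _ [cA' _ _]] _].
  exact: p1_connection_inj.
- move=> B [gB sB dB]; have [A [cA [H hH uA] _ trA BE]] := G2_instanton_descends cW hW gB sB.
  exists A => //; split=> //; exists H => //; split=> //.
  by apply/(induces_dbar_p1 cA); rewrite BE.
- move=> A [cA hA F11 trA]; split; last exact: S1_invariant_p1.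
  exact: G2_instanton_p1.
- move=> A A' /set_mem[cA _ _ _] /set_mem[cA' _ _ _].
  exact: p1_connection_inj.
- move=> B [gB sB]; have [A [cA hA F11 trA BE]] := G2_instanton_descends cW hW gB sB.
  by exists A.
Qed.
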